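(* In the setting of the context, consider the minimal birth--death process on $E=\{i:-M-1<i<N+1\}$ with Dirichlet boundaries at $-M-1$ if $M<\infty$ and at $N+1$ if $N<\infty$, and let $(\mathbb B,\|\cdot\|_{\mathbb B},\mu)$ be a normed linear space of functions on $E$ satisfying (H1)--(H3), where $\mathscr G$ contains a locally positive element. Then the optimal constant $A_{\mathbb B}\in[0,\infty]$ in the Poincaré-type inequality $$\|f^2\|_{\mathbb B}\le A_{\mathbb B}\,D(f),\qquad f\in\mathscr D^{\min}(D),$$ satisfies $B_{\mathbb B}\le A_{\mathbb B}\le4B_{\mathbb B}$, where $$B_{\mathbb B}^{-1}=\inf_{m,n\in E:\,m\le n}\Big[\Big(\sum_{i=-M}^m\frac1{\mu_ia_i}\Big)^{-1}+\Big(\sum_{i=n}^N\frac1{\mu_ib_i}\Big)^{-1}\Big]\,\|\mathbb 1_{[m,n]}\|_{\mathbb B}^{-1}.$$ In particular, when $\mathbb B=L^{p/2}(\mu)$ with $p\ge2$, the constant $B_{\mathbb B}=:B_p$ is given by $$B_p^{-1}=\inf_{m,n\in E:\,m\le n}\Big[\Big(\sum_{i=-M}^m\frac1{\mu_ia_i}\Big)^{-1}+\Big(\sum_{i=n}^N\frac1{\mu_ib_i}\Big)^{-1}\Big]\Big(\sum_{j=m}^n\mu_j\Big)^{-2/p}.$$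
   Context: $E=\{i\in\mathbb Z:-M-1<i<N+1\}$, $M,N\le\infty$, with birth rates $b_i>0$ and death rates $a_i>0$ for all $i\in E$. $\mu=(\mu_i)_{i\in E}$ is the positive measure (unique up to a constant factor) with $\mu_ib_i=\mu_{i+1}a_{i+1}$ whenever $i,i+1\in E$. For fixed $\theta\in E$, $D(f)=\sum_{-M-1<i\le\theta}\mu_ia_i(f_i-f_{i-1})^2+\sum_{\theta\le i<N+1}\mu_ib_i(f_{i+1}-f_i)^2$ (independent of $\theta$), with $f_{-M-1}=0$ if $M<\infty$, $f_{N+1}=0$ if $N<\infty$. $\mathscr D^{\min}(D)$ is the closure of the set of finitely supported functions with respect to the norm $(\|f\|_{L^2(\mu)}^2+D(f))^{1/2}$. Hypotheses on $\mathbb B$ (compact subsets of $E$ are finite sets): (H1) if $\mu(E)=\infty$, then $\mathbb 1_K\in\mathbb B$ for all compact $K$; otherwise $1\in\mathbb B$. (H2) If $h\in\mathbb B$ and $|f|\le h$, then $f\in\mathbb B$. (H3) $\|f\|_{\mathbb B}=\sup_{g\in\mathscr G}\sum_{i\in E}\mu_i|f_i|g_i$ for a class $\mathscr G$ of nonnegative functions on $E$. ''$\mathscr G$ contains a locally positive element'' means that some $g\in\mathscr G$ satisfies $\inf_Kg>0$ for every compact $K$. Conventions: $1/\infty=0$, $1/0=\infty$; $\|f^2\|_{\mathbb B}$ is understood in $[0,\infty]$ via (H3). *)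

(* Defs.v *)
From HB Require Import structures.
From mathcomp Require Import all_boot all_order all_algebra.
From mathcomp Require Import all_classical all_reals all_analysis.

Set Implicit Arguments.
Unset Strict Implicit.
Unset Printing Implicit Defensive.

Import Order.TTheory GRing.Theory Num.Theory.

Local Open Scope classical_set_scope.
Local Open Scope ring_scope.
Local Open Scope ereal_scope.

(* M, N range over the extended integers; the value -oo makes the state space
   empty, so it is excluded as soon as a base point theta is given. *)
Definition state (M N : \bar int) : Type :=
  {i : int | - M - 1 < i%:E < N + 1}.

Section BirthDeath.
Context {R : realType} {M N : \bar int}.
Local Notation E := (state M N).
Implicit Types (a b mu f g : E -> R) (theta m n : E) (K : set E).
Implicit Types (nrm : (E -> R) -> \bar R) (B G : set (E -> R)).

Definition reversible a b mu : Prop :=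
  forall i j : E, val j = (val i + 1)%R -> (mu i * b i = mu j * a j)%R.

(* Extension by zero to all of Z, which is how the Dirichlet conditions
   f_{-M-1} = 0 (M finite) and f_{N+1} = 0 (N finite) enter the energy. *)
Definition ext0 f (j : int) : R := oapp f 0%R (insub j).

Definition energy a b mu theta f : \bar R :=
  \esum_(i in [set i : E | (val i <= val theta)%R])
     (mu i * a i * (f i - ext0 f (val i - 1)) ^+ 2)%:E
  + \esum_(i in [set i : E | (val theta <= val i)%R])
     (mu i * b i * (ext0 f (val i + 1) - f i) ^+ 2)%:E.

Definition Lp_norm mu (p : R) f : \bar R :=
  (\esum_(i in [set: E]) (mu i * `|f i| `^ p)%:E) `^ p^-1.

Definition Lp_space mu (p : R) : set (E -> R) :=
  [set f | Lp_norm mu p f < +oo].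

Definition energy_norm a b mu theta f : \bar R :=
  (Lp_norm mu 2 f ^+ 2 + energy a b mu theta f) `^ 2^-1.

Definition finitely_supported f : Prop := finite_set [set i | f i != 0%R].

(* The closure of the finitely supported functions. *)
Definition Dmin a b mu theta : set (E -> R) :=
  [set f | forall e : R, (0 < e)%R -> exists g,
     finitely_supported g /\ energy_norm a b mu theta (f \- g)%R < e%:E].

(* nrm is an extended norm, defined on all functions, whose restriction to the
   linear subspace B is a (finite) norm. *)
Record normed_function_space B nrm : Prop := NormedFunctionSpace {
  nfs_zero : B (cst 0%R);
  nfs_linear : forall (c : R) f g, B f -> B g -> B (fun i => c * f i + g i)%R;
  nfs_fin : forall f, B f -> nrm f \is a fin_num;
  nfs_scale : forall (c : R) f, B f -> nrm (fun i => c * f i)%R = `|c|%:E * nrm f;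
  nfs_triangle : forall f g, B f -> B g -> nrm (f \+ g)%R <= nrm f + nrm g;
  nfs_definite : forall f, B f -> nrm f = 0 -> forall i, f i = 0%R
}.

Definition H1 mu B : Prop :=
  if \esum_(i in [set: E]) (mu i)%:E == +oo
  then forall K, finite_set K -> B (\1_K)
  else B (cst 1%R).

Definition H2 B : Prop :=
  forall f h, B h -> (forall i, (`|f i| <= h i)%R) -> B f.

(* Stated for every f, so that it also fixes the value in [0, +oo] of the norm
   outside B. *)
Definition H3 mu nrm G : Prop :=
  (forall g, G g -> forall i, (0 <= g i)%R) /\
  (forall f, nrm f =
     ereal_sup [set \esum_(i in [set: E]) (mu i * `|f i| * g i)%:E | g in G]).

Definition locally_positive g : Prop :=
  forall K, finite_set K -> 0 < ereal_inf [set (g i)%:E | i in K].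

Record admissible mu B nrm G : Prop := Admissible {
  adm_space : normed_function_space B nrm;
  adm_H1 : H1 mu B;
  adm_H2 : H2 B;
  adm_H3 : H3 mu nrm G;
  adm_locally_positive : exists g, G g /\ locally_positive g
}.

(* The infimum is +oo when no finite A works; +oo itself may fail the inequality
   since +oo * 0 = 0. *)
Definition optimal_constant a b mu theta nrm : \bar R :=
  ereal_inf [set A | 0 <= A /\ forall f, Dmin a b mu theta f ->
    nrm (fun i => f i ^+ 2)%R <= A * energy a b mu theta f].

Definition itv_state m n : set E := [set i | (val m <= val i <= val n)%R].

Definition left_resistance a mu m : \bar R :=
  \esum_(i in [set i : E | (val i <= val m)%R]) ((mu i * a i)^-1)%:E.

Definition right_resistance b mu n : \bar R :=
  \esum_(i in [set i : E | (val n <= val i)%R]) ((mu i * b i)^-1)%:E.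

(* On \bar R the inverse satisfies 0^-1 = +oo and +oo^-1 = 0, and the norms of
   the indicators are finite and positive for an admissible nrm. *)
Definition isoperimetric_constant a b mu nrm : \bar R :=
  (ereal_inf
    [set ((left_resistance a mu mn.1)^-1 + (right_resistance b mu mn.2)^-1)
           * (nrm \1_(itv_state mn.1 mn.2))^-1
    | mn in [set mn : E * E | (val mn.1 <= val mn.2)%R]])^-1.

End BirthDeath.

(* Main.v *)
Require Import Defs.
From mathcomp Require Import all_boot all_order all_algebra.
From mathcomp Require Import all_classical all_reals all_analysis.
From mathcomp Require Import ring lra zify.

Import Order.TTheory GRing.Theory Num.Theory.

Local Open Scope classical_set_scope.
Local Open Scope ring_scope.
Local Open Scope ereal_scope.

(** [1/left_resistance m + 1/right_resistance n] is the capacity of [[m, n]].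

    Lower bound: test the inequality on approximate equilibrium potentials of
    [[m, n]], which equal 1 on [[m, n]] and decrease linearly in the resistance
    on each side along finitely many edges.

    Upper bound: for [f] finitely supported, replace [|f|] on the two sides of
    an argmax by its running maxima [F], which lowers the energy. The increments
    [p i] of [F^2] on the left and [q j] on the right have the same total mass
    [u = max f^2], and [F^2] is the sum of the functions [1_[i, j]] with weights
    [p i * q j / u]; so the hypothesis on intervals bounds the norm of [f^2] by
    the sums of [p i / left_resistance i] and of [q j / right_resistance j].
    Each of them is at most 4 times the energy on its side, a discrete form of
    Hardy's inequality. The inequality passes to the closure with the elementary
    bound [x^2 <= (1 + d) y^2 + (1 + 1/d) (y - x)^2].

    For [L^q], [(H3)] holds for the positive part of the dual unit ball, by
    Hoelder's inequality and its equality case. *)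

(** * Weighted inequality on a finite line *)

Section FiniteLine.
Set Implicit Arguments.
Unset Strict Implicit.
Unset Printing Implicit Defensive.
Local Open Scope ring_scope.
Context {R : realFieldType}.
Implicit Types (p q w phi c l : nat -> R).

(* The hypothesis says that [1/l' = 1/l + 1/c] when [l <> 0], and still makes
   sense when the resistance [1/l] is infinite. The two terms without a
   difference telescope. *)
Lemma hardy_step (x y c l l' : R) : 0 < c -> 0 <= l -> l' * (c + l) = c * l ->
  (y ^+ 2 - x ^+ 2) * l' + y ^+ 2 * l' - x ^+ 2 * l <= 4 * (c * (y - x) ^+ 2).
Proof.
move=> c0 l0 e; have cl0 : 0 < c + l by lra.
rewrite -(ler_pM2r cl0) -subr_ge0.
(* After multiplication by [c + l], the hypothesis [e] eliminates [l'], and completing the square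
   displays the difference of the two sides as nonnegative. *)
suff -> : 4 * (c * (y - x) ^+ 2) * (c + l)
   - ((y ^+ 2 - x ^+ 2) * l' + y ^+ 2 * l' - x ^+ 2 * l) * (c + l)
   = (2 * c * (y - x) - l * x) ^+ 2 + 2 * c * l * (y - x) ^+ 2.
  have h : 0 <= 2 * c * l by rewrite !mulr_ge0// ltW.
  by rewrite addr_ge0 ?sqr_ge0// mulr_ge0 ?sqr_ge0.
have -> : ((y ^+ 2 - x ^+ 2) * l' + y ^+ 2 * l' - x ^+ 2 * l) * (c + l) =
   (2 * y ^+ 2 - x ^+ 2) * (l' * (c + l)) - x ^+ 2 * l * (c + l) by ring.
by rewrite e; ring.
Qed.

(** The extra boundary term [phi n.+1 ^+ 2 * l n] makes the induction close: [hardy_step] trades it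
    for the next one and pays with the energy of the new edge. *)
Lemma hardy_nat phi c l n : phi 0%N = 0 ->
  (forall i, (i <= n)%N -> 0 < c i) -> (forall i, (i <= n)%N -> 0 <= l i) ->
  l 0%N <= c 0%N ->
  (forall i, (i < n)%N -> l i.+1 * (c i.+1 + l i) = c i.+1 * l i) ->
  \sum_(i < n.+1) (phi i.+1 ^+ 2 - phi i ^+ 2) * l i + phi n.+1 ^+ 2 * l n
    <= 4 * \sum_(i < n.+1) c i * (phi i.+1 - phi i) ^+ 2.
Proof.
move=> phi0; elim: n => [|n IH] c0 l0 lc rec.
  rewrite !big_ord_recr !big_ord0 /= phi0 !add0r !(expr0n,subr0) /=.
  have := sqr_ge0 (phi 1%N); have := l0 0%N isT => h1 h2.
  have : phi 1%N ^+ 2 * l 0%N <= phi 1%N ^+ 2 * c 0%N by apply: ler_wpM2l.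
  by have : 0 <= phi 1%N ^+ 2 * c 0%N; [apply: mulr_ge0 => //; lra|lra].
have -> : \sum_(i < n.+2) c i * (phi i.+1 - phi i) ^+ 2 =
    \sum_(i < n.+1) c i * (phi i.+1 - phi i) ^+ 2
      + c n.+1 * (phi n.+2 - phi n.+1) ^+ 2 by rewrite big_ord_recr.
rewrite big_ord_recr/= mulrDr.
have {}IH := IH (fun i h => c0 i (leqW h)) (fun i h => l0 i (leqW h)) lc
  (fun i h => rec i (leqW h)).
have := hardy_step (phi n.+1) (phi n.+2) (c0 n.+1 (leqnn _)) (l0 n (leqnSn _))
  (rec n (leqnn _)).
lra.
Qed.

Fixpoint running_max phi n : R :=
  if n is n'.+1 then Num.max (running_max phi n') (phi n) else phi 0%N.

Lemma le_running_max phi n i : (i <= n)%N -> phi i <= running_max phi n.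
Proof.
elim: n => [|n IH]; first by rewrite leqn0 => /eqP ->.
by rewrite leq_eqVlt => /orP[/eqP ->|/IH h] /=; rewrite le_max ?lexx ?orbT// h.
Qed.

Lemma running_max_le phi n x :
  (forall i, (i <= n)%N -> phi i <= x) -> running_max phi n <= x.
Proof.
elim: n => [|n IH] h /=; first exact: h.
by rewrite ge_max h// IH// => i /leqW; apply: h.
Qed.

Lemma running_max_ge0 phi n : phi 0%N = 0 -> 0 <= running_max phi n.
Proof. by move=> <-; exact: le_running_max. Qed.

Lemma running_max_mono phi n : running_max phi n <= running_max phi n.+1.
Proof. by rewrite /= le_max lexx. Qed.

Lemma running_max_top phi k :
  (forall i, (i <= k)%N -> phi i <= phi k) -> running_max phi k = phi k.
Proof.
by move=> h; apply/eqP; rewrite eq_le le_running_max// andbT running_max_le.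
Qed.

(** When the running maximum increases, it starts from a value at least [phi n] and ends at
    [phi n.+1]. *)
Lemma running_max_contr phi n :
  (running_max phi n.+1 - running_max phi n) ^+ 2 <= (phi n.+1 - phi n) ^+ 2.
Proof.
have := le_running_max phi (leqnn n); rewrite /=.
set F := running_max phi n => h.
case: (leP (phi n.+1) F) => h2; first by rewrite subrr expr0n sqr_ge0.
by rewrite ler_pXn2r ?nnegrE //; lra.
Qed.

(** A telescoping sum cut at [m]; it evaluates the two factors produced by [coupling_le] at a
    vertex. *)
Lemma sum_running_max phi n m : phi 0%N = 0 ->
  \sum_(i < n | (i < m)%N) (running_max phi i.+1 ^+ 2 - running_max phi i ^+ 2)
    = running_max phi (minn n m) ^+ 2.
Proof.
move=> phi0; elim: n => [|n IH].
  by rewrite big_ord0 min0n /= phi0 expr0n.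
rewrite big_mkcond big_ord_recr/= -big_mkcond/= IH.
case: (boolP (n < m)%N); rewrite ?ltnNge ?negbK -?ltnNge => h.
  by rewrite (minn_idPl (ltnW h)) (minn_idPl h) addrC subrK.
by rewrite (minn_idPr h) (minn_idPr (leqW h)) addr0.
Qed.

(* Both families have total mass [u], so [p i * q j / u] is a coupling of them
   which turns the hypothesis on the sets [A i `&` B j] into a weighted sum. *)
Lemma coupling_le (I J V : finType) (p l : I -> R) (q r : J -> R)
    (A : I -> pred V) (B : J -> pred V) (w : V -> R) (C u : R) :
  (forall i, 0 <= p i) -> (forall j, 0 <= q j) -> 0 < u ->
  \sum_i p i = u -> \sum_j q j = u ->
  (forall i j, \sum_(v | A i v && B j v) w v <= C * (l i + r j)) ->
  \sum_v w v * ((\sum_(i | A i v) p i) * (\sum_(j | B j v) q j)) <=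
    u * (C * (\sum_i p i * l i + \sum_j q j * r j)).
Proof.
move=> p0 q0 u0 pu qu hw.
have -> : \sum_v w v * ((\sum_(i | A i v) p i) * (\sum_(j | B j v) q j)) =
    \sum_i \sum_j p i * q j * \sum_(v | A i v && B j v) w v.
  under eq_bigr => v _.
    rewrite big_distrlr mulr_sumr/=.
    under eq_bigr => i _ do rewrite mulr_sumr big_mkcond.
    rewrite big_mkcond; over.
  rewrite exchange_big/=; apply: eq_bigr => i _.
  under [RHS]eq_bigr => j _ do rewrite mulr_sumr big_mkcond.
  rewrite [RHS]exchange_big/=; apply: eq_bigr => v _.
  case: (A i v) => /=; last by rewrite big1.
  by apply: eq_bigr => j _; case: (B j v) => //=; rewrite mulrC.
apply: (@le_trans _ _ (\sum_i \sum_j p i * q j * (C * (l i + r j)))).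
  by apply: ler_sum => i _; apply: ler_sum => j _; rewrite ler_wpM2l ?mulr_ge0.
rewrite le_eqVlt; apply/orP; left; apply/eqP.
(* Summing out [q] in the terms with [l], and [p] in those with [r], leaves a factor [u] each
   time. *)
transitivity (\sum_i (C * u * (p i * l i) + C * (\sum_j q j * r j) * p i)).
  apply: eq_bigr => i _.
  transitivity (\sum_j (C * (p i * l i) * q j + C * p i * (q j * r j))).
    by apply: eq_bigr => j _; ring.
  by rewrite big_split/= -!mulr_sumr qu; ring.
by rewrite big_split/= -!mulr_sumr pu; ring.
Qed.

Lemma maximal_inequality phi c l k : phi 0%N = 0 -> (0 < k)%N ->
  (forall i, (i < k)%N -> 0 < c i) -> (forall i, (i < k)%N -> 0 <= l i) ->
  l 0%N <= c 0%N ->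
  (forall i, (i.+1 < k)%N -> l i.+1 * (c i.+1 + l i) = c i.+1 * l i) ->
  \sum_(i < k) (running_max phi i.+1 ^+ 2 - running_max phi i ^+ 2) * l i
    <= 4 * \sum_(i < k) c i * (phi i.+1 - phi i) ^+ 2.
Proof.
case: k => // k phi0 _ c0 l0 lc rec.
have := hardy_nat (phi := running_max phi) phi0 c0 l0 lc rec.
have : 0 <= running_max phi k.+1 ^+ 2 * l k by rewrite mulr_ge0 ?sqr_ge0 ?l0.
have : \sum_(i < k.+1) c i * (running_max phi i.+1 - running_max phi i) ^+ 2
  <= \sum_(i < k.+1) c i * (phi i.+1 - phi i) ^+ 2.
  apply: ler_sum => i _; rewrite ler_pM2l ?running_max_contr//.
  exact: c0.
lra.
Qed.

(** The vertices are [0] to [T.+1], both ends being absorbing, and edge [i] joins [i] to [i.+1]. The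
    conductance towards the left is [l i] at the vertex [i.+1], and towards the right [r j] at
    [T - j]. At the ends only [l 0 <= c 0] and [r 0 <= c T] are asked, since the network may
    continue beyond them. *)
Lemma poincare_finite_line (T : nat) (phi w c l r : nat -> R) (C : R) :
  phi 0%N = 0 -> phi T.+1 = 0 -> (forall i, 0 <= phi i) -> (forall i, 0 <= w i) ->
  0 <= C ->
  (forall i, (i <= T)%N -> 0 < c i) ->
  (forall i, (i < T)%N -> 0 <= l i) -> (forall i, (i < T)%N -> 0 <= r i) ->
  l 0%N <= c 0%N ->
  (forall i, (i.+1 < T)%N -> l i.+1 * (c i.+1 + l i) = c i.+1 * l i) ->
  r 0%N <= c T ->
  (forall i, (i.+1 < T)%N ->
    r i.+1 * (c (T - i.+1)%N + r i) = c (T - i.+1)%N * r i) ->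
  (forall i j, (i + j < T)%N ->
    \sum_(v < T.+2 | (i < v)%N && (j < T.+1 - v)%N) w v <= C * (l i + r j)) ->
  \sum_(v < T.+2) w v * phi v ^+ 2 <=
    4 * C * \sum_(i < T.+1) c i * (phi i.+1 - phi i) ^+ 2.
Proof.
move=> phi0 phiT phi_ge0 w0 C0 c0 l0 r0 lc lrec rc rrec hw.
pose k : 'I_T.+2 := [arg max_(i > ord0) phi i]%O.
have kmax (i : 'I_T.+2) : phi i <= phi k.
  by rewrite /k; case: arg_maxP => // j _; apply.
have sum_ge0 : 0 <= \sum_(i < T.+1) c i * (phi i.+1 - phi i) ^+ 2.
  by apply: sumr_ge0 => i _; rewrite mulr_ge0 ?sqr_ge0// ltW// c0// -ltnS.
have [k0|kn0] := eqVneq (phi k) 0.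
  rewrite big1 ?mulr_ge0// => i _.
  suff -> : phi i = 0 by rewrite expr0n mulr0.
  by apply/eqP; rewrite eq_le phi_ge0 andbT -k0.
have u0 : 0 < phi k ^+ 2 by rewrite exprn_gt0// lt_neqAle eq_sym kn0 phi_ge0.
have k_gt0 : (0 < k)%N by rewrite lt0n; apply: contra kn0 => /eqP ->; rewrite phi0.
have k_leT : (k <= T)%N.
  rewrite -ltnS ltn_neqAle -ltnS ltn_ord andbT.
  by apply: contra kn0 => /eqP ->; rewrite phiT.
(* The reflected function reduces the right side of the argmax [k] to the left one. *)
pose psi i := phi (T.+1 - i)%N.
have psi0 : psi 0%N = 0 by rewrite /psi subn0.
pose k' := (T.+1 - k)%N.
have psik : psi k' = phi k by rewrite /psi /k' subKn// ltnW.
have topl : running_max phi k = phi k.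
  apply: running_max_top => // i ik.
  have iT : (i < T.+2)%N by apply: leq_ltn_trans ik _.
  exact: (kmax (Ordinal iT)).
have topr : running_max psi k' = phi k.
  rewrite -psik; apply: running_max_top => i ik; rewrite psik.
  have iT : (T.+1 - i < T.+2)%N by rewrite ltnS leq_subr.
  exact: (kmax (Ordinal iT)).
have := @maximal_inequality phi c l k phi0 k_gt0
  (fun i h => c0 i (leq_trans (ltnW h) k_leT)) (fun i h => l0 i (leq_trans h k_leT)) lc
  (fun i h => lrec i (leq_trans h k_leT)).
have k'T : (k' <= T)%N by rewrite /k'; lia.
have := @maximal_inequality psi (fun i => c (T - i)%N) r k' psi0 _ _
  (fun i h => r0 i (leq_trans h k'T)) _ (fun i h => rrec i (leq_trans h k'T)).
rewrite subn0 => /(_ _ _ rc) right.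
have {}right := right ltac:(rewrite /k'; lia) ltac:(by move=> i _; apply: c0; rewrite leq_subr).
move=> left.
pose p (i : 'I_k) := running_max phi i.+1 ^+ 2 - running_max phi i ^+ 2.
pose q (j : 'I_k') := running_max psi j.+1 ^+ 2 - running_max psi j ^+ 2.
have step_ge0 (f : nat -> R) i : f 0%N = 0 -> 0 <= running_max f i.+1 ^+ 2 - running_max f i ^+ 2.
  move=> f0; rewrite subr_ge0 ler_pXn2r ?nnegrE ?running_max_ge0//.
  exact: running_max_mono.
have sump : \sum_i p i = phi k ^+ 2.
  have := @sum_running_max phi k k phi0; rewrite minnn topl => <-.
  by apply: eq_bigl => i; rewrite ltn_ord.
have sumq : \sum_i q i = phi k ^+ 2.
  have := @sum_running_max psi k' k' psi0; rewrite minnn topr => <-.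
  by apply: eq_bigl => i; rewrite ltn_ord.
have := @coupling_le _ _ 'I_T.+2 p (fun i => l i) q (fun j => r j)
  (fun i v => (i < v)%N) (fun j v => (j < T.+1 - v)%N) (fun v => w v) C _
  (fun i => step_ge0 phi i phi0) (fun j => step_ge0 psi j psi0) u0 sump sumq.
have hw' (i : 'I_k) (j : 'I_k') :
    \sum_(v < T.+2 | (i < v)%N && (j < T.+1 - v)%N) w v <= C * (l i + r j).
  by apply: hw; have := ltn_ord i; have := ltn_ord j; rewrite /k'; lia.
move=> /(_ hw') coup.
rewrite -(ler_pM2l u0); apply: le_trans (le_trans _ coup) _; last first.
  rewrite ler_pM2l// [4 * C]mulrC -mulrA ler_wpM2l//.
  pose a i := c i * (phi i.+1 - phi i) ^+ 2.
  (* The energy splits at [k], the edges on its right being read backwards. *)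
  have -> : \sum_(i < T.+1) c i * (phi i.+1 - phi i) ^+ 2 = \sum_(i < k) a i
      + \sum_(i < k') c (T - i)%N * (psi i.+1 - psi i) ^+ 2.
    transitivity (\sum_(0 <= i < T.+1) a i); first by rewrite big_mkord.
    rewrite (@big_cat_nat _ _ _ k)/=; [|by []|exact: leqW].
    rewrite big_mkord; congr (_ + _).
    rewrite -{1}[nat_of_ord k]add0n big_addn big_nat_rev/= big_mkord.
    apply: eq_bigr => i _; have := ltn_ord i; rewrite /k' /a /psi => ik.
    have -> : (0 + (T.+1 - k) - i.+1 + k = T - i)%N by lia.
    have -> : ((T - i).+1 = T.+1 - i)%N by lia.
    by have -> : (T.+1 - i.+1 = T - i)%N by []; rewrite -sqrrN opprB.
  by rewrite mulrDr lerD.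
(* At each vertex, [phi k ^+ 2 * phi v ^+ 2] is at most the product of the two squared running
   maxima: the one coming from across [k] has reached [phi k], and the other is at least [phi v]. *)
rewrite mulr_sumr; apply: ler_sum => v _.
rewrite mulrCA ler_wpM2l//.
rewrite (sum_running_max k v phi0) (sum_running_max k' (T.+1 - v) psi0).
have [vk|kv] := leqP v k.
  have -> : minn k' (T.+1 - v) = k' by apply/minn_idPl; rewrite /k'; lia.
  rewrite topr mulrC ler_wpM2r ?sqr_ge0// ler_pXn2r ?nnegrE ?running_max_ge0//.
  exact: le_running_max.
have -> : minn k' (T.+1 - v) = (T.+1 - v)%N by apply/minn_idPr; rewrite /k'; lia.
rewrite topl ler_wpM2l ?sqr_ge0// ler_pXn2r ?nnegrE ?running_max_ge0//.
have {1}-> : phi v = psi (T.+1 - v)%N by rewrite /psi subKn// -ltnS ltn_ord.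
exact: le_running_max.
Qed.

End FiniteLine.

(** * Sums over the state space as sums over the integers *)

Section EsumExtra.
Set Implicit Arguments.
Unset Strict Implicit.
Unset Printing Implicit Defensive.
Context {R : realType} {T T' : choiceType}.
Implicit Types (S : set T) (F : T -> \bar R) (s : seq T).

Lemma esum_ge_seq S F s : uniq s -> (forall x, x \in s -> S x) ->
  \sum_(x <- s) F x <= \esum_(x in S) F x.
Proof.
move=> us sS; apply: esum_ge; exists [set` s]; last by rewrite fsbig_seq.
by split; [exact: finite_seq|move=> x /=; exact: sS].
Qed.

Lemma esum_le_seq S F y :
  (forall s, uniq s -> (forall x, x \in s -> S x) -> \sum_(x <- s) F x <= y) ->
  \esum_(x in S) F x <= y.
Proof.
move=> h; apply: ge_ereal_sup => _ /= [X [finX XS] <-].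
rewrite fsbig_finite//; apply: h => [|x]; first exact: finmap.fset_uniq.
by rewrite in_fset_set// inE => /XS.
Qed.

Lemma esum_seq_gt S F y : y < \esum_(x in S) F x ->
  exists s, [/\ uniq s, forall x, x \in s -> S x & y < \sum_(x <- s) F x].
Proof.
move=> /ereal_sup_gt[_ [X [finX XS] <-] yX]; exists (finmap.enum_fset (fset_set X)); split.
- exact: finmap.fset_uniq.
- by move=> x; rewrite in_fset_set// inE => /XS.
- by rewrite -fsbig_finite.
Qed.

Lemma esum_subset S S' F : (forall x, 0 <= F x) -> S `<=` S' ->
  \esum_(x in S) F x <= \esum_(x in S') F x.
Proof.
move=> F0 SS'; apply: esum_le_seq => s us sS; apply: esum_ge_seq => // x /sS.
exact: SS'.
Qed.

Lemma esum_support S S' F : S `<=` S' ->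
  (forall x, S' x -> ~ S x -> F x = 0) ->
  \esum_(x in S') F x = \esum_(x in S) F x.
Proof.
move=> SS' F0; rewrite esum_mkcond [RHS]esum_mkcond; apply: eq_esum => x _.
case: ifPn => [/set_mem xS'|xS']; case: ifPn => [/set_mem xS|xS] //.
- by rewrite F0// => /mem_set; apply/negP.
- by move/negP: xS'; case; apply/mem_set/SS'.
Qed.

(** Serves to carry sums over states, or over a stretch of naturals, to sums over the integers,
    where the missing terms vanish. *)
Lemma reindex_esum_support (e : T' -> T) S F : injective e ->
  (forall x, S x -> (forall y, e y <> x) -> F x = 0) ->
  \esum_(y in e @^-1` S) F (e y) = \esum_(x in S) F x.
Proof.
move=> e_inj F0; rewrite -(esum_image _ e F); last by move=> x y _ _ /e_inj.
rewrite -(@esum_support _ S)//; first by move=> _ [y /= ? <-].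
move=> x Sx xe; apply: F0 => // y yx; apply: xe.
by exists y => //=; rewrite yx.
Qed.

Lemma esumZl S F (c : R) : (0 < c)%R -> (forall x, 0 <= F x) ->
  \esum_(x in S) (c%:E * F x) = c%:E * \esum_(x in S) F x.
Proof.
move=> c0 F0; rewrite /esum -ereal_sup_pZl//; congr ereal_sup.
rewrite image_comp; apply: eq_imagel => X [finX _] /=.
by rewrite ge0_mule_fsumr.
Qed.

End EsumExtra.

(** * The chain as an electrical network on the integers *)

Section Lifting.
Set Implicit Arguments.
Unset Strict Implicit.
Unset Printing Implicit Defensive.
Context {R : realType} {M N : \bar int}.
Local Notation E := (state M N).
Implicit Types (a b mu f g : E -> R) (theta m n : E).

Lemma state_convex (i k : E) (j : int) : (val i <= j)%R -> (j <= val k)%R ->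
  exists x : E, val x = j.
Proof.
move=> ij jk; have /andP[h1 _] := valP i; have /andP[_ h2] := valP k.
suff h : (- M - 1 < j%:E < N + 1) by exists (exist _ j h).
by rewrite (lt_le_trans h1) ?lee_fin// (le_lt_trans _ h2)// lee_fin.
Qed.

Lemma ext0_val f (i : E) : ext0 f (val i) = f i.
Proof. by rewrite /ext0 valK. Qed.

Lemma ext0_out f (j : int) : (forall i : E, val i <> j) -> ext0 f j = 0%R.
Proof. by rewrite /ext0; case: insubP => // i _ <- /(_ i). Qed.

Lemma ext0_ge0 f (j : int) : (forall i, 0 <= f i)%R -> (0 <= ext0 f j)%R.
Proof. by rewrite /ext0 => f0; case: insubP => /=. Qed.

Lemma state_cases (j : int) : (exists i : E, val i = j) \/ (forall i : E, val i <> j).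
Proof.
by case: (pselect (exists i : E, val i = j)) => [|/forallNP]; [left|right].
Qed.

Lemma val_state_inj : injective (val : E -> int).
Proof. exact: val_inj. Qed.

Lemma val1_state_inj : injective (fun i : E => (val i + 1)%R : int).
Proof. by move=> i j /addIr/val_inj. Qed.

(* Conductance of the edge joining [j - 1] to [j], the two boundary edges of [E]
   included; it is [0] on the other edges, whose resistance is thus [0^-1 = 0]. *)
Definition conductance a b mu (j : int) : R :=
  oapp (fun i : E => mu i * a i)%R (ext0 (fun i => mu i * b i) (j - 1))%R (insub j).

Section Network.
Variables (a b mu : E -> R).
Hypotheses (ha : forall i, (0 < a i)%R) (hb : forall i, (0 < b i)%R).
Hypotheses (hmu : forall i, (0 < mu i)%R) (hrev : reversible a b mu).
Let cc := conductance a b mu.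

Lemma conductance_left (i : E) : cc (val i) = (mu i * a i)%R.
Proof. by rewrite /cc /conductance valK. Qed.

Lemma conductance_right (i : E) : cc (val i + 1) = (mu i * b i)%R.
Proof.
rewrite /cc /conductance; case: insubP => [j _ vj|_] /=; first by rewrite -(hrev vj).
by rewrite addrK ext0_val.
Qed.

Lemma conductance_out (j : int) : (forall i : E, val i <> j) ->
  (forall i : E, (val i + 1)%R <> j) -> cc j = 0%R.
Proof.
rewrite /cc /conductance => h1 h2; case: insubP => [i _ vi|_] /=.
  by case: (h1 i).
by apply: ext0_out => i ij; apply: (h2 i); rewrite ij subrK.
Qed.

Lemma conductance_ge0 (j : int) : (0 <= cc j)%R.
Proof.
rewrite /cc /conductance; case: insubP => [i _ _|_] /=; first by rewrite mulr_ge0 ?ltW.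
by apply: ext0_ge0 => i; rewrite mulr_ge0 ?ltW.
Qed.

(** If [j - 1] were a state, then [j], lying between it and [m], would be one too by convexity. *)
Lemma conductance_out_left (m : E) (j : int) : (j <= val m)%R ->
  (forall i : E, val i <> j) -> cc j = 0%R.
Proof.
move=> jm out; apply: conductance_out => // i ij.
have [|x xj] := @state_convex i m j _ jm; first by lia.
exact: (out x xj).
Qed.

Lemma conductance_out_right (n : E) (j : int) : (val n < j)%R ->
  (forall i : E, (val i + 1)%R <> j) -> cc j = 0%R.
Proof.
move=> nj out; apply: conductance_out => // i ij.
have [||x xj] := @state_convex n i (j - 1)%R; [lia|lia|].
by apply: (out x); rewrite xj subrK.
Qed.

Lemma left_resistanceE (m : E) :
  left_resistance a mu m = \esum_(j in [set j | (j <= val m)%R]) ((cc j)^-1)%:E.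
Proof.
rewrite -(reindex_esum_support val_state_inj); last first.
  by move=> j /= jm out; rewrite (conductance_out_left jm)// invr0.
by apply: eq_esum => i _; rewrite conductance_left.
Qed.

Lemma right_resistanceE (n : E) :
  right_resistance b mu n = \esum_(j in [set j | (val n < j)%R]) ((cc j)^-1)%:E.
Proof.
rewrite -(reindex_esum_support val1_state_inj); last first.
  by move=> j /= jm out; rewrite (conductance_out_right jm)// invr0.
rewrite /right_resistance (_ : _ @^-1` _ = [set i : E | (val n <= val i)%R]).
  by apply: eq_esum => i _; rewrite conductance_right.
by apply/seteqP; split => i /=; lia.
Qed.

(** The first sum of the energy covers the edges indexed up to [val theta], and the second, shifted
    by one, the edges after it. Hence the value does not depend on [theta]. *)
Lemma energyE theta f : energy a b mu theta f =
  \esum_(j in [set: int]) (cc j * (ext0 f j - ext0 f (j - 1)) ^+ 2)%:E.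
Proof.
rewrite (esumID [set j | (j <= val theta)%R]); last first.
  by move=> j _; rewrite lee_fin mulr_ge0 ?conductance_ge0 ?sqr_ge0.
rewrite !setTI; congr (_ + _).
  rewrite -(reindex_esum_support val_state_inj); last first.
    by move=> j /= jm out; rewrite (conductance_out_left jm)// mul0r.
  by apply: eq_esum => i _; rewrite conductance_left ext0_val.
rewrite -(reindex_esum_support val1_state_inj); last first.
  move=> j /= /negP; rewrite -ltNge => jm out.
  by rewrite (conductance_out_right jm)// mul0r.
rewrite (_ : _ @^-1` _ = [set i : E | (val theta <= val i)%R]).
  by apply: eq_esum => i _; rewrite conductance_right addrK ext0_val.
apply/seteqP; split => i /=; last by move=> ?; apply/negP; lia.
by move/negP; lia.
Qed.

Lemma esum_stateE f :
  \esum_(i in [set: E]) (f i)%:E = \esum_(j in [set: int]) (ext0 f j)%:E.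
Proof.
rewrite -(reindex_esum_support val_state_inj); last first.
  by move=> j _ /ext0_out ->.
by rewrite preimage_setT; apply: eq_esum => i _; rewrite ext0_val.
Qed.

End Network.
End Lifting.

(** * Finitely supported functions *)

Section Resistance.
Set Implicit Arguments.
Unset Strict Implicit.
Unset Printing Implicit Defensive.
Context {R : realType}.
Variable c : int -> R.
Hypothesis c_ge0 : forall j, (0 <= c j)%R.

Definition left_res (j : int) : \bar R := \esum_(i in [set i | (i <= j)%R]) ((c i)^-1)%:E.
Definition right_res (j : int) : \bar R := \esum_(i in [set i | (j < i)%R]) ((c i)^-1)%:E.
(** An infinite resistance gives conductance 0, as it should. For resistance 0, [fine] returns the
    default value 0; the lemmas that need the true value assume positive conductances. *)
Definition left_cond j : R := fine (left_res j)^-1.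
Definition right_cond j : R := fine (right_res j)^-1.

Let inv_ge0 j : 0 <= ((c j)^-1)%:E.
Proof. by rewrite lee_fin invr_ge0. Qed.

Lemma left_res_ge0 j : 0 <= left_res j. Proof. by apply: esum_ge0. Qed.
Lemma right_res_ge0 j : 0 <= right_res j. Proof. by apply: esum_ge0. Qed.

Lemma left_cond_ge0 j : (0 <= left_cond j)%R.
Proof. by rewrite fine_ge0// inve_ge0 left_res_ge0. Qed.

Lemma right_cond_ge0 j : (0 <= right_cond j)%R.
Proof. by rewrite fine_ge0// inve_ge0 right_res_ge0. Qed.

Lemma left_res_step j : left_res j = left_res (j - 1) + ((c j)^-1)%:E.
Proof.
rewrite /left_res (esumID [set i | (i <= j - 1)%R])//; congr (_ + _).
  by congr esum; apply/seteqP; split => i /=; lia.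
rewrite -(@esum_set1 _ _ j (fun j => (c j)^-1%:E))//.
congr esum; apply/seteqP; split => i /=; first by move=> [? /negP]; lia.
by move=> ->; split; [|apply/negP]; lia.
Qed.

Lemma right_res_step j : right_res (j - 1) = right_res j + ((c j)^-1)%:E.
Proof.
rewrite /right_res (esumID [set i | (j < i)%R])//; congr (_ + _).
  by congr esum; apply/seteqP; split => i /=; lia.
rewrite -(@esum_set1 _ _ j (fun j => (c j)^-1%:E))//.
congr esum; apply/seteqP; split => i /=; first by move=> [? /negP]; lia.
by move=> ->; split; [|apply/negP]; lia.
Qed.

Lemma series_conductance_le (y : \bar R) (k : R) : 0 <= y -> (0 < k)%R ->
  (fine (y + (k^-1)%:E)^-1 <= k)%R.
Proof.
case: y => [y| |]// y0 k0; last by rewrite addye//= ltW.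
have k1 : (0 < k^-1)%R by rewrite invr_gt0.
rewrite -EFinD fine_invr -[leRHS]invrK lef_pV2 ?posrE//.
  by rewrite lerDr -lee_fin.
by rewrite ltr_wpDl -?lee_fin.
Qed.

(** The law of resistors in series with denominators cleared, as [hardy_step] takes it. For
    [y = +oo] both sides are 0. *)
Lemma series_conductanceE (y : \bar R) (k : R) : 0 < y -> (0 < k)%R ->
  (fine (y + (k^-1)%:E)^-1 * (k + fine y^-1) = k * fine y^-1)%R.
Proof.
case: y => [y| |]// y0 k0; last by rewrite addye//= mul0r mulr0.
rewrite lte_fin in y0; rewrite -EFinD !fine_invr.
have k1 : (0 < k^-1)%R by rewrite invr_gt0.
have h : (k * y + 1 != 0)%R by rewrite gt_eqF// addr_gt0// mulr_gt0.
by field; rewrite [(y * k)%R]mulrC h andbT !gt_eqF.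
Qed.

Lemma left_res_gt0 j : (0 < c j)%R -> 0 < left_res j.
Proof.
move=> h; rewrite left_res_step; apply: lt_le_trans (leeDr _ (left_res_ge0 _)).
by rewrite lte_fin invr_gt0.
Qed.

Lemma right_res_gt0 j : (0 < c (j + 1))%R -> 0 < right_res j.
Proof.
move=> h; have := right_res_step (j + 1); rewrite addrK => ->.
by apply: lt_le_trans (leeDr _ (right_res_ge0 _)); rewrite lte_fin invr_gt0.
Qed.

Lemma left_cond_le j : (0 < c j)%R -> (left_cond j <= c j)%R.
Proof.
by move=> h; rewrite /left_cond left_res_step series_conductance_le ?left_res_ge0.
Qed.

Lemma left_cond_step j : (0 < c (j - 1))%R -> (0 < c j)%R ->
  (left_cond j * (c j + left_cond (j - 1)) = c j * left_cond (j - 1))%R.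
Proof.
by move=> h' h; rewrite /left_cond [in LHS]left_res_step series_conductanceE ?left_res_gt0.
Qed.

Lemma right_cond_le j : (0 < c (j + 1))%R -> (right_cond j <= c (j + 1))%R.
Proof.
move=> h; have := right_res_step (j + 1); rewrite addrK /right_cond => ->.
by rewrite series_conductance_le ?right_res_ge0.
Qed.

Lemma right_cond_step j : (0 < c (j + 1))%R -> (0 < c j)%R ->
  (right_cond (j - 1) * (c j + right_cond j) = c j * right_cond j)%R.
Proof.
by move=> h' h; rewrite /right_cond [in LHS]right_res_step series_conductanceE ?right_res_gt0.
Qed.

End Resistance.

Lemma esum_fin (R : realType) (I : finType) (F : I -> \bar R) :
  (forall i, 0 <= F i) -> \esum_(i in [set: I]) F i = \sum_i F i.
Proof.
move=> F0; rewrite esum_fset//; last exact: finite_finset.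
rewrite [LHS](fsbig_fwiden (index_enum I))//.
- by move=> i _; rewrite /= mem_index_enum.
- exact: index_enum_uniq.
- by move=> i /= [_]; case.
Qed.

(** * Transfer of the inequality from the finite line to the state space *)

Section PoincareFinite.
Set Implicit Arguments.
Unset Strict Implicit.
Unset Printing Implicit Defensive.
Context {R : realType} {M N : \bar int}.
Local Notation E := (state M N).
Variables (a b mu : E -> R) (theta : E).
Hypotheses (ha : forall i, (0 < a i)%R) (hb : forall i, (0 < b i)%R).
Hypotheses (hmu : forall i, (0 < mu i)%R) (hrev : reversible a b mu).
Let cc := conductance a b mu.
Let cc_ge0 := conductance_ge0 ha hb hmu.

Lemma finite_state_bounds (K : set E) : finite_set K ->
  exists s t : E, (val s <= val t)%R /\
    forall i, K i -> (val s <= val i <= val t)%R.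
Proof.
move=> /finite_seqP[r ->].
elim: (r : seq E) => [|x {}r [s [t [st h]]]].
  by exists theta, theta.
have [s' [s's s'x]] : exists s' : E, (val s' <= val s)%R /\ (val s' <= val x)%R.
  have [?|?] : (val s <= val x)%R \/ (val x <= val s)%R by lia.
    by exists s; split => //; lia.
  by exists x; split => //; lia.
have [t' [tt' xt']] : exists t' : E, (val t <= val t')%R /\ (val x <= val t')%R.
  have [?|?] : (val t <= val x)%R \/ (val x <= val t)%R by lia.
    by exists x; split => //; lia.
  by exists t; split => //; lia.
exists s', t'; split; first by lia.
move=> i ir; have : i \in x :: r by [].
by rewrite inE => /orP[/eqP ->|/h]; lia.
Qed.

Lemma conductance_left_gt0 (i : E) : (0 < cc (val i))%R.
Proof. by rewrite /cc conductance_left mulr_gt0. Qed.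

Lemma conductance_right_gt0 (i : E) : (0 < cc (val i + 1))%R.
Proof. by rewrite /cc conductance_right// mulr_gt0. Qed.

(** The hull of the support, enlarged by one vertex on each side, is laid on a finite line, with
    [|f|] extended by zero. The conductances [left_cond] and [right_cond] take the rest of the
    network into account, so the constant is the same for all supports. *)
Lemma poincare_finite_support (f g : E -> R) (C : R) :
  finitely_supported f -> (0 <= C)%R -> (forall i, (0 <= g i)%R) ->
  (forall m n : E, (val m <= val n)%R ->
    \esum_(i in itv_state m n) (mu i * g i)%:E
      <= (C * (left_cond cc (val m) + right_cond cc (val n)))%:E) ->
  \esum_(i in [set: E]) (mu i * f i ^+ 2 * g i)%:E
    <= (4 * C)%:E * energy a b mu theta f.
Proof.
move=> /finite_state_bounds[s [t [st supp]]] C0 g0 hC.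
(* [T] is the number of states from [s] to [t]. The map [e] sends [0] and [T.+1] to [val s - 1] and
   [val t + 1], which may lie outside the state space; [ext0 f] vanishes there in any case. *)
pose T := `|val t - val s|%N.+1.
have TE : (T%:Z = val t - val s + 1)%R by rewrite /T; lia.
pose e (v : nat) : int := (val s - 1 + v%:Z)%R.
have eS v : e v.+1 = (e v + 1)%R by rewrite /e; lia.
have e_inj : injective e by move=> u v; rewrite /e; lia.
have e_state v : (0 < v)%N -> (v < T.+1)%N -> exists i : E, val i = e v.
  by move=> v0 vT; apply: (@state_convex _ _ s t); rewrite /e; lia.
have f_out (j : int) : (j < val s)%R || (val t < j)%R -> ext0 f j = 0%R.
  move=> jst; have [[i ij]|/ext0_out//] := @state_cases M N j.
  rewrite -ij ext0_val; apply/eqP; apply: contraT => /supp; lia.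
pose phi (v : nat) : R := `|ext0 f (e v)|%R.
pose w v := ext0 (fun i => mu i * g i)%R (e v).
pose ce v := cc (e v.+1).
pose l v := left_cond cc (e v.+1).
pose r v := right_cond cc (e (T - v)%N).
have key : (\sum_(v < T.+2) w v * phi v ^+ 2 <=
    4 * C * \sum_(v < T.+1) ce v * (phi v.+1 - phi v) ^+ 2)%R.
  have ce_gt0 v : (v <= T)%N -> (0 < ce v)%R.
    move=> vT; rewrite /ce eS; case: (posnP v) => [->|v0].
      by rewrite (_ : e 0%N + 1 = val s)%R ?conductance_left_gt0// /e; lia.
    by have [i <-] := e_state v v0 vT; rewrite conductance_right_gt0.
  apply: (poincare_finite_line (l := l) (r := r)) => //.
  - by rewrite /phi f_out ?normr0// /e; apply/orP; left; lia.
  - by rewrite /phi f_out ?normr0// /e; apply/orP; right; lia.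
  - by move=> i; rewrite /phi.
  - by move=> i; rewrite /w ext0_ge0// => j; rewrite mulr_ge0// ltW.
  - by move=> i _; exact: left_cond_ge0.
  - by move=> i _; exact: right_cond_ge0.
  - by apply: left_cond_le => //; exact: ce_gt0.
  - move=> i iT; rewrite /l /ce (eS i.+1).
    have := @left_cond_step _ _ cc_ge0 (e i.+1 + 1); rewrite addrK => -> //.
      by apply: ce_gt0; lia.
    by rewrite -eS; apply: (ce_gt0 i.+1); lia.
  - rewrite /r /ce subn0 eS; apply: right_cond_le => //.
    by rewrite -eS; exact: ce_gt0.
  - move=> i iT; rewrite /r /ce.
    have -> : e (T - i)%N = (e (T - i.+1)%N + 1)%R by rewrite -eS; congr e; lia.
    have := @right_cond_step _ _ cc_ge0 (e (T - i.+1)%N + 1); rewrite addrK -!eS => -> //.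
      by apply: (ce_gt0 (T - i.+1).+1); lia.
    by apply: (ce_gt0 (T - i.+1)%N); lia.
  - move=> i j ijT.
    have [m mE] : exists m : E, val m = e i.+1 by apply: e_state; lia.
    have [n nE] : exists n : E, val n = e (T - j)%N by apply: e_state; lia.
    have mn : (val m <= val n)%R by rewrite mE nE /e; lia.
    have := hC m n mn; rewrite mE nE -lee_fin; apply: le_trans.
    rewrite (_ : itv_state m n = val @^-1` [set k : int | (val m <= k <= val n)%R])//.
    under eq_esum do rewrite -(ext0_val (fun i => mu i * g i)%R).
    rewrite (reindex_esum_support (@val_state_inj _ _)
      (F := fun j => (ext0 (fun i => mu i * g i)%R j)%:E)); last first.
      by move=> k _ /ext0_out ->.
    rewrite -sumEFin -(big_mkord (fun v => (i < v)%N && (j < T.+1 - v)%N) (fun v => (w v)%:E)).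
    rewrite -big_filter -(big_map e predT (fun j => (ext0 (fun i => mu i * g i)%R j)%:E)).
    apply: esum_ge_seq; first by rewrite map_inj_uniq// filter_uniq// iota_uniq.
    move=> x /mapP[v]; rewrite mem_filter mem_index_iota => h -> /=.
    by rewrite mE nE /e; lia.
have -> : \esum_(i in [set: E]) (mu i * f i ^+ 2 * g i)%:E =
    (\sum_(v < T.+2) w v * phi v ^+ 2)%:E.
  rewrite esum_stateE -(reindex_esum_support (e := fun v : 'I_T.+2 => e v)); last 2 first.
  - by move=> u v /e_inj/val_inj.
  - move=> j _ out; have [[i ij]|/ext0_out ->//] := @state_cases M N j.
    rewrite -ij ext0_val (_ : f i = 0%R) ?expr0n/= ?mulr0 ?mul0r//.
    rewrite -(ext0_val f) ij f_out//.
    apply: contraT; rewrite negb_or -!leNgt => /andP[h1 h2].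
    have jT : (absz (j - val s + 1)%R < T.+2)%N by lia.
    have ej : e (absz (j - val s + 1)%R) = j by rewrite /e; lia.
    by have := out (Ordinal jT); rewrite ej.

  rewrite preimage_setT esum_fin; last first.
    move=> v; rewrite lee_fin ext0_ge0// => i.
    by apply: mulr_ge0 => //; apply: mulr_ge0; rewrite ?sqr_ge0// ltW.
  rewrite -sumEFin; apply: eq_bigr => v _; congr EFin.
  rewrite /w /phi real_normK ?num_real// /ext0; case: insub => [i|] /=.
    by rewrite mulrAC.
  by rewrite mul0r.
(* Only the edges of the line are kept, and taking absolute values does not increase differences. *)
have E_ge : (\sum_(v < T.+1) ce v * (phi v.+1 - phi v) ^+ 2)%:E
    <= energy a b mu theta f.
  rewrite energyE//.
  apply: (@le_trans _ _ (\sum_(v < T.+1)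
      (ce v * (ext0 f (e v.+1) - ext0 f (e v.+1 - 1)) ^+ 2)%:E)).
    rewrite -sumEFin; apply: lee_sum => v _; rewrite lee_fin ler_wpM2l ?cc_ge0//.
    rewrite eS addrK -(real_normK (num_real (phi _ - _)))
      -[leRHS]real_normK ?num_real// ler_pXn2r ?nnegrE//.
    by rewrite /phi eS; exact: ler_dist_dist.
  rewrite -(big_mkord predT (fun v => (ce v * (ext0 f (e v.+1) - ext0 f (e v.+1 - 1)) ^+ 2)%:E)).
  rewrite -(big_map (fun v => e v.+1) predT
    (fun j => (cc j * (ext0 f j - ext0 f (j - 1)) ^+ 2)%:E)).
  apply: esum_ge_seq => //; rewrite map_inj_uniq ?iota_uniq//.
  by move=> u v /e_inj [].
apply: (@le_trans _ _ ((4 * C)%:E * (\sum_(v < T.+1) ce v * (phi v.+1 - phi v) ^+ 2)%:E)).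
  by rewrite -EFinM lee_fin.
by rewrite lee_wpmul2l// lee_fin mulr_ge0.
Qed.

End PoincareFinite.

(** * The upper bound *)

Section UpperBound.
Set Implicit Arguments.
Unset Strict Implicit.
Unset Printing Implicit Defensive.
Context {R : realType} {M N : \bar int}.
Local Notation E := (state M N).
Variables (a b mu : E -> R) (theta : E).
Hypotheses (ha : forall i, (0 < a i)%R) (hb : forall i, (0 < b i)%R).
Hypotheses (hmu : forall i, (0 < mu i)%R) (hrev : reversible a b mu).
Let cc := conductance a b mu.
Let cc_ge0 := conductance_ge0 ha hb hmu.

Lemma finite_itv_state (m n : E) : finite_set (itv_state m n).
Proof.
rewrite (_ : itv_state m n = val @^-1` [set k : int | (val m <= k <= val n)%R])//.
apply: finite_preimage; first by move=> x y _ _ /val_inj.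
apply: (@sub_finite_set _ _ ((fun v : nat => val m + v%:Z)%R @` `I_(absz (val n - val m)%R).+1)).
  by move=> k /= h; exists (absz (k - val m)%R) => /=; lia.
exact/finite_image/finite_II.
Qed.

Lemma energy_ge0 (f : E -> R) : 0 <= energy a b mu theta f.
Proof.
rewrite energyE//; apply: esum_ge0 => j _.
by rewrite lee_fin mulr_ge0 ?sqr_ge0 ?cc_ge0.
Qed.

(** Both resistances are positive because the edge next to the endpoint has positive conductance and
    finite nonzero resistance; so the inverses are finite and [fine] loses nothing. *)
Lemma sum_conductance (m n : E) :
  (left_resistance a mu m)^-1 + (right_resistance b mu n)^-1 =
  (left_cond cc (val m) + right_cond cc (val n))%:E.
Proof.
rewrite (left_resistanceE a b) (right_resistanceE hrev) EFinD /left_cond /right_cond.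
have h1 := conductance_left_gt0 b ha hmu m; have h2 := conductance_right_gt0 hb hmu hrev n.
rewrite !fineK// fin_numV//.
- by rewrite gt_eqF// (right_res_gt0 cc_ge0).
- by rewrite -ltNye (lt_le_trans _ (right_res_ge0 cc_ge0 _)).
- by rewrite gt_eqF// (left_res_gt0 cc_ge0).
- by rewrite -ltNye (lt_le_trans _ (left_res_ge0 cc_ge0 _)).
Qed.

Lemma sqr_le_perturbed (d x y : R) : (0 < d)%R ->
  (x ^+ 2 <= (1 + d) * y ^+ 2 + (1 + d^-1) * (y - x) ^+ 2)%R.
Proof.
move=> d0; rewrite -subr_ge0.
suff -> : ((1 + d) * y ^+ 2 + (1 + d^-1) * (y - x) ^+ 2 - x ^+ 2 =
    d^-1 * (d * y + (y - x)) ^+ 2)%R.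
  by rewrite mulr_ge0 ?sqr_ge0// invr_ge0 ltW.
by field; rewrite gt_eqF.
Qed.

Lemma energy_perturbed (d : R) (f h : E -> R) : (0 < d)%R ->
  energy a b mu theta h <= (1 + d)%:E * energy a b mu theta f
    + (1 + d^-1)%:E * energy a b mu theta (f \- h)%R.
Proof.
move=> d0; have d1 : (0 < d^-1)%R by rewrite invr_gt0.
have F0 (u : E -> R) j : 0 <= (cc j * (ext0 u j - ext0 u (j - 1)) ^+ 2)%:E.
  by rewrite lee_fin mulr_ge0 ?sqr_ge0 ?cc_ge0.
rewrite !energyE// -!esumZl ?addr_gt0// -esumD; last 2 first.
- by move=> j _; rewrite mule_ge0 ?F0// lee_fin addr_ge0// ltW.
- by move=> j _; rewrite mule_ge0 ?F0// lee_fin addr_ge0// ltW.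
apply: le_esum => j _; rewrite -!EFinM -EFinD lee_fin.
have ext0B k : ext0 (f \- h)%R k = (ext0 f k - ext0 h k)%R.
  by rewrite /ext0; case: insub => [i|] /=; rewrite ?subr0.
rewrite !ext0B.
have := sqr_le_perturbed (ext0 h j - ext0 h (j - 1)) (ext0 f j - ext0 f (j - 1)) d0.
move=> /(ler_wpM2l (cc_ge0 j)) /le_trans; apply.
by rewrite le_eqVlt; apply/orP; left; apply/eqP; rewrite /cc; ring.
Qed.

(** The two consequences of closeness in norm that the passage to the closure uses: small energy and
    smallness at each state. *)
Lemma energy_norm_lt (u : E -> R) (e : R) : (0 < e)%R ->
  energy_norm a b mu theta u < e%:E ->
  energy a b mu theta u <= (e ^+ 2)%:E /\ forall i, (mu i * u i ^+ 2 <= e ^+ 2)%R.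
Proof.
move=> e0; rewrite /energy_norm /Lp_norm.
set S := \esum_(i in _) _; set D := energy _ _ _ _ _ => lte.
have S0 : 0 <= S.
  by apply: esum_ge0 => i _; rewrite lee_fin mulr_ge0 ?powR_ge0// ltW.
have D0 : 0 <= D by exact: energy_ge0.
have SE : (S `^ 2^-1) ^+ 2 = S.
  case: S S0 {lte} => [s| |]// s0.
    by rewrite poweR_EFin powR12_sqrt// -EFin_expe sqr_sqrtr.
  by rewrite poweRyr ?invr_eq0// expe2 mulyy.
rewrite SE in lte.
have {lte} SDe : S + D <= (e ^+ 2)%:E.
  move: lte; case: (S + D) (adde_ge0 S0 D0) => [y| |]// y0.
    rewrite poweR_EFin powR12_sqrt// lte_fin lee_fin => h.
    rewrite -(sqr_sqrtr y0) ler_pXn2r ?nnegrE ?sqrtr_ge0//; exact: ltW.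
  by rewrite poweRyr ?invr_eq0.
split; first exact: le_trans (leeDr _ S0) SDe.
move=> i; rewrite -lee_fin; apply: le_trans (le_trans (leeDl _ D0) SDe).
have := @esum_ge_seq _ _ [set: E] (fun i => (mu i * `|u i| `^ 2)%:E) [:: i] isT (fun _ _ => I).
by rewrite big_seq1 powR_mulrn// real_normK ?num_real.
Qed.

(** It suffices to bound the sum over a finite sequence of states, for which control at each state
    is enough, although [g] may be unbounded. *)
Lemma poincare_Dmin (A : R) (g f : E -> R) : (0 < A)%R ->
  (forall i, (0 <= g i)%R) ->
  (forall h, finitely_supported h ->
    \esum_(i in [set: E]) (mu i * h i ^+ 2 * g i)%:E <= A%:E * energy a b mu theta h) ->
  Dmin a b mu theta f ->
  \esum_(i in [set: E]) (mu i * f i ^+ 2 * g i)%:E <= A%:E * energy a b mu theta f.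
Proof.
move=> A0 g0 fin Df.
case Ef : (energy a b mu theta f) (energy_ge0 f) => [d| |]// d0; last first.
  by rewrite gt0_muley// leey.
rewrite lee_fin in d0.
apply: esum_le_seq => s us _; rewrite sumEFin -EFinM lee_fin.
set X := (\sum_(i <- s) _)%R.
pose G := (\sum_(i <- s) g i)%R.
have G0 : (0 <= G)%R by apply: sumr_ge0.
(* The same [t] is the distance of the approximation and the parameter of the perturbation, so the
   error [(1 + t^-1) * t ^+ 2] is [t ^+ 2 + t]. The factor of [t] collects all errors, with higher
   powers of [t] bounded by [t]. *)
have key (t : R) : (0 < t)%R -> (t <= 1)%R ->
    (X <= A * d + t * (3 * A * d + 4 * A + 2 * G))%R.
  move=> t0 t1; have [h [fh /energy_norm_lt]] := Df t t0.
  move=> /(_ t0)[Efh ptw].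
  have Eh : energy a b mu theta h <= ((1 + t) * d + (t ^+ 2 + t))%:E.
    apply: le_trans (energy_perturbed f h t0) _; rewrite Ef.
    rewrite [leRHS]EFinD [((1 + t) * d)%R%:E]EFinM leeD2l//.
    apply: (@le_trans _ _ ((1 + t^-1)%:E * (t ^+ 2)%:E)).
      by rewrite lee_wpmul2l// lee_fin addr_ge0// invr_ge0 ltW.
    rewrite -EFinM lee_fin le_eqVlt; apply/orP; left; apply/eqP.
    by field; rewrite gt_eqF.
  have Sh : (\sum_(i <- s) mu i * h i ^+ 2 * g i <= A * ((1 + t) * d + (t ^+ 2 + t)))%R.
    rewrite -lee_fin -sumEFin; apply: (@le_trans _ _ (A%:E * energy a b mu theta h)).
      by apply: le_trans (fin h fh); exact: esum_ge_seq.
    by rewrite EFinM lee_wpmul2l// lee_fin ltW.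
  have Xle : (X <= (1 + t) * \sum_(i <- s) mu i * h i ^+ 2 * g i + (t + t ^+ 2) * G)%R.
    rewrite !mulr_sumr -big_split/=; apply: ler_sum => i _.
    have mg : (0 <= mu i * g i)%R by rewrite mulr_ge0// ltW.
    have h1 := ler_wpM2l mg (sqr_le_perturbed (f i) (h i) t0).
    have h2 : (g i * (1 + t^-1) * (mu i * (f i - h i) ^+ 2) <= g i * (1 + t^-1) * t ^+ 2)%R.
      by apply: ler_wpM2l (ptw i); rewrite mulr_ge0// addr_ge0// invr_ge0 ltW.
    have h3 : (g i * (1 + t^-1) * t ^+ 2 = (t + t ^+ 2) * g i)%R.
      by field; rewrite gt_eqF.
    rewrite -h3; apply: le_trans (lerD (lexx _) h2).
    rewrite mulrAC; apply: le_trans h1 _.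
    by rewrite le_eqVlt; apply/orP; left; apply/eqP; ring.
  have t2 : (t ^+ 2 <= t)%R by rewrite expr2 ler_piMl// ltW.
  have t3 : (t ^+ 2 * t <= t)%R by apply: le_trans t2; rewrite ler_piMr ?sqr_ge0.
  apply: (le_trans Xle).
  have h1 := ler_wpM2l (_ : 0 <= 1 + t)%R Sh.
  have {}h1 := h1 ltac:(lra).
  apply: (le_trans (lerD h1 (lexx _))).
  have Ad : (0 <= A * d)%R by rewrite mulr_ge0// ltW.
  have e1 := ler_wpM2l Ad t2.
  have e2 := ler_wpM2l (ltW A0) t2; have e3 := ler_wpM2l (ltW A0) t3.
  have e4 := ler_wpM2l G0 t2.
  have -> : ((1 + t) * (A * ((1 + t) * d + (t ^+ 2 + t))) + (t + t ^+ 2) * G =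
    A * d + 2 * (A * d * t) + A * d * t ^+ 2 + A * t + 2 * (A * t ^+ 2)
     + A * (t ^+ 2 * t) + G * t + G * t ^+ 2)%R by ring.
  have -> : (t * (3 * A * d + 4 * A + 2 * G) =
    3 * (A * d * t) + 4 * (A * t) + 2 * (G * t))%R by ring.
  lra.
pose K := (3 * A * d + 4 * A + 2 * G)%R.
have K0 : (0 < K)%R.
  have : (0 <= A * d)%R by rewrite mulr_ge0// ltW.
  by rewrite /K -mulrA; lra.
apply/ler_addgt0Pr => e e0.
(* The error [t * K] is brought below [e] by [t = e / K], or by [t = 1] when [K < e]. *)
have [h|h] := leP e K.
  have := key (e / K)%R; rewrite divr_gt0// ler_pdivrMr// mul1r => /(_ isT h).
  by rewrite -/K divfK// gt_eqF.
by apply: le_trans (key 1%R ltr01 (lexx 1%R)) _; rewrite mul1r lerD2l -/K ltW.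
Qed.

(** * Comparison of the optimal constant with the isoperimetric constant from above *)

Section Isoperimetric.
Variables (B : set (E -> R)) (nrm : (E -> R) -> \bar R) (G : set (E -> R)).
Hypothesis adm : admissible mu B nrm G.

Lemma nrm_mono (f g : E -> R) : (forall i, `|f i| <= `|g i|)%R -> nrm f <= nrm g.
Proof.
case: adm => _ _ _ [G0 nrmE] _ fg; rewrite !nrmE.
apply: ge_ereal_sup => _ [k Gk <-]; apply: le_ereal_sup_tmp.
exists (\esum_(i in [set: E]) (mu i * `|g i| * k i)%:E).
  by exists k.
apply: le_esum => i _; rewrite lee_fin ler_wpM2r ?(G0 k)//.
by rewrite ler_wpM2l// ltW.
Qed.

(** [H1] and [H2] put the indicator in [B], so its norm is finite; the locally positive element of
    [G] makes it positive. *)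
Lemma nrm_indic (K : set E) : finite_set K -> K !=set0 ->
  exists2 v : R, nrm \1_K = v%:E & (0 < v)%R.
Proof.
move=> finK [x Kx]; case: adm => sp h1 h2 [G0 nrmE] [g [Gg posg]].
have BK : B \1_K.
  move: h1; rewrite /H1; case: ifP => _; first exact.
  by move=> B1; apply: h2 B1 _ => i; rewrite indicE; case: (_ \in _); rewrite ?normr0 ?normr1.
have fK := nfs_fin sp BK; exists (fine (nrm \1_K)); first by rewrite fineK.
rewrite -lte_fin fineK//.
rewrite nrmE; apply: lt_le_trans (ereal_sup_ubound (ex_intro2 _ _ g Gg erefl)).
have := @esum_ge_seq _ _ [set: E] (fun i => (mu i * `|\1_K i| * g i)%:E) [:: x] isT (fun _ _ => I).
rewrite big_seq1 indicE mem_set// normr1 mulr1 => /(lt_le_trans _); apply.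
rewrite lte_fin mulr_gt0//.
have := posg [set x] (finite_set1 x).
by rewrite image_set1 ereal_inf1 lte_fin.
Qed.

Lemma isoperimetric_inf_ge0 : 0 <= ereal_inf
    [set ((left_resistance a mu mn.1)^-1 + (right_resistance b mu mn.2)^-1)
           * (nrm \1_(itv_state mn.1 mn.2))^-1
    | mn in [set mn : E * E | (val mn.1 <= val mn.2)%R]].
Proof.
apply: le_ereal_inf_tmp => _ [[m n] /= mn <-].
have [|v -> v0] := nrm_indic (finite_itv_state m n).
    by exists m; rewrite /itv_state/= lexx.
rewrite sum_conductance mule_ge0//.
  by rewrite lee_fin addr_ge0// (left_cond_ge0 cc_ge0, right_cond_ge0 cc_ge0).
by rewrite inve_ge0 lee_fin ltW.
Qed.

Lemma isoperimetric_bound (C : R) :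
  isoperimetric_constant a b mu nrm = C%:E ->
  (0 < C)%R /\ forall m n : E, (val m <= val n)%R ->
    nrm \1_(itv_state m n) <= (C * (left_cond cc (val m) + right_cond cc (val n)))%:E.
Proof.
rewrite /isoperimetric_constant; set X := ereal_inf _ => XC.
have X0 : 0 <= X := isoperimetric_inf_ge0.
have Xle (m n : E) : (val m <= val n)%R -> exists v : R, [/\ (0 < v)%R,
    nrm \1_(itv_state m n) = v%:E &
    X <= ((left_cond cc (val m) + right_cond cc (val n)) / v)%:E].
  move=> mn; have [|v vE v0] := nrm_indic (finite_itv_state m n).
    by exists m; rewrite /itv_state/= lexx.
  exists v; split => //; rewrite EFinM -sum_conductance.
  have -> : (v^-1)%:E = (nrm \1_(itv_state m n))^-1 by rewrite vE inver gt_eqF.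
  by apply: ereal_inf_lbound; exists (m, n).
(* One pair already bounds the infimum by a finite number, so its inverse [C] is not 0. *)
have [v0 [_ _ Xlt]] := Xle theta theta (lexx _).
have XE : X = (C%:E)^-1 by rewrite -XC inveK.
have C0 : C != 0%R.
  by apply/eqP => C0; move: Xlt; rewrite XE C0 inve0 leye_eq.
have Cgt : (0 < C)%R.
  by rewrite lt_neqAle eq_sym C0 -lee_fin -XC inve_ge0.
split => // m n /Xle[v [vpos -> ]]; rewrite XE inver (negbTE C0) !lee_fin.
rewrite ler_pdivlMr// mulrC ler_pdivrMr//.
by rewrite mulrC.
Qed.

(** By [H3] the norm is a supremum of weighted sums, and each weight [g] in [G] satisfies the
    interval condition with the same [C]; the resulting bound is therefore uniform in [g]. *)
Lemma optimal_le : optimal_constant a b mu theta nrm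
  <= 4%:E * isoperimetric_constant a b mu nrm.
Proof.
case XC : (isoperimetric_constant a b mu nrm) => [C| |]; last 2 first.
- by rewrite gt0_muley ?lte_fin// leey.
- have : 0 <= isoperimetric_constant a b mu nrm by rewrite inve_ge0 isoperimetric_inf_ge0.
  by rewrite XC.
have [C0 hC] := isoperimetric_bound XC.
apply: ereal_inf_lbound; split; first by rewrite -EFinM lee_fin mulr_ge0// ltW.
move=> f Df; have [_ _ _ [G0 nrmE] _] := adm.
rewrite nrmE; apply: ge_ereal_sup => _ [g Gg <-].
under eq_esum do rewrite (ger0_norm (sqr_ge0 _)).
rewrite -EFinM; apply: poincare_Dmin => //; first by rewrite mulr_gt0.
  exact: G0.
move=> h fh; apply: (poincare_finite_support (a := a) (b := b) (mu := mu)) => //.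
- exact: ltW.
- exact: G0.
move=> m n mn; apply: le_trans (hC m n mn); rewrite nrmE.
apply: le_trans (ereal_sup_ubound (ex_intro2 _ _ g Gg erefl)).
rewrite esum_mkcond; apply: le_esum => i _; rewrite indicE.
by case: (i \in _); rewrite ?normr1 ?mulr1 ?normr0 ?mulr0 ?mul0r.
Qed.

End Isoperimetric.
End UpperBound.

(** * The lower bound *)

Section LowerBound.
Set Implicit Arguments.
Unset Strict Implicit.
Unset Printing Implicit Defensive.
Context {R : realType} {M N : \bar int}.
Local Notation E := (state M N).
Variables (a b mu : E -> R) (theta : E).
Hypotheses (ha : forall i, (0 < a i)%R) (hb : forall i, (0 < b i)%R).
Hypotheses (hmu : forall i, (0 < mu i)%R) (hrev : reversible a b mu).
Let cc := conductance a b mu.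
Let cc_ge0 := conductance_ge0 ha hb hmu.

(** Builds a test function from its increments. Zero total makes it vanish far to the right, and
    zero increments on absent edges make it vanish outside the state space, as the Dirichlet
    conditions demand. *)
Lemma primitive_energy (K : seq int) (d : int -> R) : uniq K ->
  (\sum_(k <- K) d k = 0)%R -> (forall j, cc j = 0 -> d j = 0)%R ->
  let f (i : E) := (\sum_(k <- K | (k <= val i)%R) d k)%R in
  finitely_supported f /\
  energy a b mu theta f = (\sum_(k <- K) cc k * d k ^+ 2)%:E.
Proof.
move=> uK d_sum d_supp f.
pose F (i : int) := (\sum_(k <- K | (k <= i)%R) d k)%R.
have F_le (i : int) : (forall k, (k <= i)%R -> k \in K -> d k = 0%R) -> F i = 0%R.
  by move=> h; rewrite /F big1_seq// => k /andP[/h].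
have F_gt (i : int) : (forall k, k \in K -> (i < k)%R -> d k = 0%R) -> F i = 0%R.
  move=> h; transitivity (\sum_(k <- K) d k)%R; last by [].
  rewrite /F [RHS](bigID (fun k => (k <= i)%R))/=.
  rewrite [X in _ = (_ + X)%R]big1_seq ?addr0// => k /andP[ki kK].
  by apply: h => //; rewrite ltNge.
(* To the left of the states no increment has been met yet; to their right all of them have been,
   and they sum to 0. *)
have Fext i : ext0 f i = F i.
  have [[x <-]|out] := @state_cases M N i; first by rewrite ext0_val.
  rewrite ext0_out//; symmetry.
  have [it|ti] : (i <= val theta)%R \/ (val theta < i)%R by lia.
    apply: F_le => k ki _; apply: d_supp.
    apply: (conductance_out_left a b mu (m := theta)); first by lia.
    move=> x xk; have [||y /out//] := @state_convex _ _ x theta i; lia.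
  apply: F_gt => k _ ik; apply: d_supp.
  apply: (conductance_out_right a b mu (n := theta)); first by lia.
  move=> x xk; have [||y /out//] := @state_convex _ _ theta x i; lia.
have dF j : (F j - F (j - 1) = if j \in K then d j else 0)%R.
  have -> : F j = (F (j - 1) + \sum_(k <- K | k == j) d k)%R.
    rewrite /F (bigID (fun k => k == j))/= addrC.
    by congr (_ + _)%R; apply: eq_bigl => k; lia.
  rewrite addrAC subrr add0r; case: ifPn => jK; last first.
    by rewrite big1_seq// => k /andP[/eqP ->]; rewrite (negbTE jK).
  by rewrite -big_filter filter_pred1_uniq// big_seq1.
split.
  have [D D0 leD] : exists2 D : int, (0 <= D)%R & forall k, k \in K -> (`|k| <= D)%R.
    exists (\sum_(k <- K) `|k|)%R; first exact: sumr_ge0.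
    by move=> k kK; rewrite (bigD1_seq k)//= lerDl; exact: sumr_ge0.
  apply: (@sub_finite_set _ _ (val @^-1` ((fun v : nat => v%:Z - D)%R @` `I_(absz (D + D)%R).+1))).
    have cover (z : int) : (- D <= z <= D)%R ->
        ((fun v : nat => v%:Z - D)%R @` `I_(absz (D + D)%R).+1) z.
      by move=> zD; exists (absz (z + D)%R); rewrite /=; lia.
    move=> i fi; apply: cover; apply: contraR fi.
    rewrite negb_and -!ltNge => /orP[h|h]; apply/eqP.
      by apply: (F_le (val i)) => k ki /leD; lia.
    by apply: (F_gt (val i)) => k /leD; lia.
  apply: finite_preimage; first by move=> x y _ _ /val_inj.
  exact/finite_image/finite_II.
rewrite energyE//; under eq_esum do rewrite !Fext dF.
rewrite (@esum_support _ _ [set` K])//; last first.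
  by move=> j _ /negP/negbTE ->; rewrite expr0n/= mulr0.
rewrite esum_fset; [|exact: finite_seq|]; last first.
  by move=> j _; rewrite lee_fin mulr_ge0 ?sqr_ge0 ?cc_ge0.
rewrite -fsbig_seq// sumEFin; congr EFin.
by rewrite big_seq [RHS]big_seq; apply: eq_bigr => j ->.
Qed.

(** Finitely many edges nearly exhaust the resistance. When it is infinite, the target [fine +oo^-1]
    is 0 and the finite sum has to exceed [e^-1]. *)
Lemma approx_resistance (S : set int) (e : R) : (0 < e)%R ->
  0 < \esum_(i in S) ((cc i)^-1)%:E ->
  exists J : seq int, [/\ uniq J, forall j, j \in J -> S j,
    (0 < \sum_(j <- J) (cc j)^-1)%R &
    ((\sum_(j <- J) (cc j)^-1)^-1 <= fine (\esum_(i in S) ((cc i)^-1)%:E)^-1 + e)%R].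
Proof.
move=> e0; set L := \esum_(_ in _) _ => L0.
pose x := fine L^-1; have x0 : (0 <= x)%R by rewrite fine_ge0// inve_ge0 ltW.
have xe : (0 < x + e)%R by lra.
have : ((x + e)^-1)%:E < L.
  move: L0 @x x0 xe; case: L => [l| |]//= l0 x0 xe; last by rewrite ltry.
  rewrite lte_fin in l0; move: xe x0; rewrite fine_invr => xe x0.
  by rewrite lte_fin -[ltRHS]invrK ltf_pV2 ?posrE ?invr_gt0//; lra.
move=> /esum_seq_gt[J [uJ JS]]; rewrite sumEFin lte_fin => ltJ.
have J0 : (0 < \sum_(j <- J) (cc j)^-1)%R by apply: lt_trans ltJ; rewrite invr_gt0.
exists J; split => //.
by rewrite -[leRHS]invrK lef_pV2 ?posrE ?invr_gt0// ltW.
Qed.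

Lemma test_function (m n : E) (e : R) : (val m <= val n)%R -> (0 < e)%R ->
  exists f : E -> R, [/\ finitely_supported f,
    forall i, itv_state m n i -> f i = 1%R &
    energy a b mu theta f <= (left_cond cc (val m) + right_cond cc (val n) + 2 * e)%:E].
Proof.
move=> mn e0.
have [J1 [uJ1 J1m S1 le1]] := approx_resistance e0
  (left_res_gt0 cc_ge0 (conductance_left_gt0 b ha hmu m)).
have [J2 [uJ2 J2n S2 le2]] := approx_resistance e0
  (right_res_gt0 cc_ge0 (conductance_right_gt0 hb hmu hrev n)).
have {}J1m (j : int) : j \in J1 -> (j <= val m)%R := J1m j.
have {}J2n (j : int) : j \in J2 -> (val n < j)%R := J2n j.
rewrite -/(left_res cc _) -/(left_cond cc (val m)) in le1.
rewrite -/(right_res cc _) -/(right_cond cc (val n)) in le2.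
set s1 := (\sum_(j <- J1) _)%R in S1 le1; set s2 := (\sum_(j <- J2) _)%R in S2 le2.
(* Increments proportional to the resistances: the function rises from 0 to 1 along [J1] and falls
   back along [J2], with energies [s1^-1] and [s2^-1]. *)
pose d (j : int) : R := (if (j <= val m)%R then (cc j)^-1 / s1 else - ((cc j)^-1 / s2))%R.
have dJ1 j : j \in J1 -> d j = ((cc j)^-1 / s1)%R by move=> /J1m h; rewrite /d h.
have dJ2 j : j \in J2 -> d j = (- ((cc j)^-1 / s2))%R.
  by move=> /J2n h; rewrite /d ifF//; lia.
have sd1 : (\sum_(j <- J1) d j = 1)%R.
  rewrite (eq_big_seq (fun j => (cc j)^-1 / s1)%R)// -mulr_suml.
  by rewrite divff// gt_eqF.
have sd2 : (\sum_(j <- J2) d j = -1)%R.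
  rewrite (eq_big_seq (fun j => - ((cc j)^-1 / s2))%R)// sumrN -mulr_suml.
  by rewrite divff// gt_eqF.
have [|||fin en] := @primitive_energy (J1 ++ J2) d.
- rewrite cat_uniq uJ1 uJ2 andbT /=; apply/hasPn => j /J2n h2.
  by apply/negP => /J1m; lia.
- by rewrite big_cat/= sd1 sd2 subrr.
- by move=> j j0; rewrite /d j0 invr0 !mul0r oppr0 if_same.
have cr j : (cc j * (cc j)^-1 ^+ 2 = (cc j)^-1)%R.
  have [->|h] := eqVneq (cc j) 0%R; first by rewrite invr0 mul0r.
  by rewrite expr2 mulrA divff// mul1r.
set f := (fun i : E => _) in fin en; exists f; split => //.
  move=> i /andP[mi ni].
  have -> : f i = (\sum_(k <- J1 | (k <= val i)%R) d k
      + \sum_(k <- J2 | (k <= val i)%R) d k)%R by rewrite /f big_cat.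
  rewrite [X in (_ + X)%R]big1_seq ?addr0; last first.
    by move=> j /andP[ji /J2n jn]; have := lt_le_trans jn (le_trans ji ni); rewrite ltxx.
  rewrite big_seq_cond (eq_bigl (fun j => j \in J1)) -?big_seq//.
  by move=> j; have [/J1m h|//] := boolP (j \in J1); rewrite (le_trans h mi).
rewrite en lee_fin big_cat/=.
have -> : (\sum_(j <- J1) cc j * d j ^+ 2 = s1^-1)%R.
  rewrite (eq_big_seq (fun j => (cc j)^-1 * s1^-1 ^+ 2)%R).
    by rewrite -mulr_suml -/s1 expr2 mulrA divff ?mul1r// gt_eqF.
  by move=> j /dJ1 ->; rewrite exprMn mulrA cr.
have -> : (\sum_(j <- J2) cc j * d j ^+ 2 = s2^-1)%R.
  rewrite (eq_big_seq (fun j => (cc j)^-1 * s2^-1 ^+ 2)%R).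
    by rewrite -mulr_suml -/s2 expr2 mulrA divff ?mul1r// gt_eqF.
  by move=> j /dJ2 ->; rewrite sqrrN exprMn mulrA cr.
lra.
Qed.

Lemma finitely_supported_Dmin (f : E -> R) :
  finitely_supported f -> Dmin a b mu theta f.
Proof.
move=> ff e e0; exists f; split => //.
have -> : (f \- f)%R = cst 0%R by apply/funext => i /=; rewrite subrr.
rewrite /energy_norm /Lp_norm esum1; last first.
  by move=> i _; rewrite normr0 powR0 ?mulr0.
rewrite /energy !esum1.
- by rewrite !poweR0r ?invr_eq0// expe2 mule0 !adde0 poweR0r ?invr_eq0// lte_fin.
- by move=> i _; rewrite /ext0; case: insub => [?|] /=; rewrite subrr expr0n/= mulr0.
- by move=> i _; rewrite /ext0; case: insub => [?|] /=; rewrite subrr expr0n/= mulr0.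
Qed.

Variables (B : set (E -> R)) (nrm : (E -> R) -> \bar R) (G : set (E -> R)).
Hypothesis adm : admissible mu B nrm G.

Lemma optimal_ge :
  isoperimetric_constant a b mu nrm <= optimal_constant a b mu theta nrm.
Proof.
apply: le_ereal_inf_tmp => -[r| |] /= [r0 hr]; rewrite ?leey//.
rewrite lee_fin in r0.
have bound (m n : E) (v : R) : (val m <= val n)%R -> nrm \1_(itv_state m n) = v%:E ->
    (v <= r * (left_cond cc (val m) + right_cond cc (val n)))%R.
  move=> mn vE; apply/ler_addgt0Pr => e e0.
  (* Accuracy [e / (2 * (r + 1))] keeps the error, multiplied by [2 * r], below [e]; the [+ 1]
     covers [r = 0]. *)
  have r1 : (0 < 2 * (r + 1))%R by lra.
  have [f [ff f1 Ef]] := test_function mn (divr_gt0 e0 r1).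
  have := hr f (finitely_supported_Dmin ff).
  have : v%:E <= nrm (fun i => f i ^+ 2)%R.
    rewrite -vE; apply: (nrm_mono hmu adm) => i; rewrite indicE.
    case: (boolP (i \in _)) => [/set_mem/f1 ->|_]; first by rewrite expr1n.
    by rewrite normr0.
  move=> /le_trans h /h{h} /le_trans.
  move=> /(_ (r%:E * (left_cond cc (val m) + right_cond cc (val n) + 2 * (e / (2 * (r + 1))))%:E)).
  rewrite lee_wpmul2l ?lee_fin// => /(_ isT) /le_trans; apply.
  have q0 := divr_gt0 e0 r1.
  have qe : (e / (2 * (r + 1)) * (2 * (r + 1)) = e)%R by rewrite divfK// gt_eqF.
  by rewrite mulrDr lerD2l -[leRHS]qe; nra.
have [|v vE v0] := nrm_indic hmu adm (finite_itv_state theta theta).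
  by exists theta; rewrite /itv_state/= lexx.
(* With [r = 0] the bound would force the positive norm of the indicator of a single state to
   vanish. *)
have rgt0 : (0 < r)%R.
  rewrite lt_neqAle r0 andbT; apply/eqP => r00.
  by have := bound _ _ _ (lexx _) vE; rewrite -r00 mul0r leNgt v0.
rewrite /isoperimetric_constant inve_ple ?inE; last 2 first.
- exact: (isoperimetric_inf_ge0 ha hb hmu hrev adm).
- by rewrite lee_fin.
apply: le_ereal_inf_tmp => _ [[p q] /= pq <-].
have [|u uE u0] := nrm_indic hmu adm (finite_itv_state p q).
  by exists p; rewrite /itv_state/= lexx.
rewrite (sum_conductance ha hb hmu hrev) uE !inver !gt_eqF// -EFinM lee_fin.
by rewrite ler_pdivlMr// mulrC ler_pdivrMr// mulrC; exact: bound.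
Qed.

End LowerBound.

(** * The case of Lebesgue spaces *)

Section LpNorm.
Set Implicit Arguments.
Unset Strict Implicit.
Unset Printing Implicit Defensive.
Context {R : realType} {M N : \bar int}.
Local Notation E := (state M N).
Variables (mu : E -> R) (q : R).
Hypotheses (hmu : forall i, (0 < mu i)%R) (q1 : (1 <= q)%R).
Local Notation nrm := (Lp_norm mu q).
Let Lp_int (f : E -> R) := \esum_(i in [set: E]) (mu i * `|f i| `^ q)%:E.

Let q_gt0 : (0 < q)%R. Proof. exact: lt_le_trans q1. Qed.
Let q_neq0 : (q != 0)%R. Proof. by rewrite gt_eqF. Qed.
Let qV_neq0 : (q^-1 != 0)%R. Proof. by rewrite invr_eq0. Qed.

Let term_ge0 (f : E -> R) i : 0 <= (mu i * `|f i| `^ q)%:E.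
Proof. by rewrite lee_fin mulr_ge0 ?powR_ge0// ltW. Qed.

Let Lp_int_ge0 f : 0 <= Lp_int f.
Proof. exact: esum_ge0. Qed.

Lemma Lp_norm_ge0 f : 0 <= nrm f.
Proof. exact: poweR_ge0. Qed.

Lemma Lp_normX f : nrm f `^ q = Lp_int f.
Proof. by rewrite /Lp_norm -poweRrM mulVf// poweRe1 ?Lp_int_ge0. Qed.

Lemma Lp_norm_scale (c : R) f : nrm (fun i => c * f i)%R = `|c|%:E * nrm f.
Proof.
have [->|c0] := eqVneq c 0%R.
  rewrite normr0 mul0e /Lp_norm esum1 ?poweR0r// => i _.
  by rewrite mul0r normr0 powR0// mulr0.
have nc : (0 < `|c|)%R by rewrite normr_gt0.
rewrite /Lp_norm.
under eq_esum => i _ do rewrite normrM powRM// mulrCA EFinM.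
rewrite esumZl ?powR_gt0// poweRM ?lee_fin ?powR_ge0//; last exact: Lp_int_ge0.
by rewrite poweR_EFin -powRrM mulfV// powRr1.
Qed.

(** Young's inequality for the exponents [q] and [q / (q - 1)], applied to [s] and [t ^ (q - 1)].
    The case [q = 1], whose conjugate exponent is infinite, is an equality. *)
Lemma young_powR (s t : R) : (0 <= s)%R -> (0 <= t)%R ->
  (s * t `^ (q - 1) <= q^-1 * s `^ q + (1 - q^-1) * t `^ q)%R.
Proof.
move=> s0 t0; move: q1; rewrite le_eqVlt => /orP[/eqP <-|q2].
  by rewrite subrr powRr0 powRr1// invr1 subrr mul0r addr0 mul1r mulr1.
have p0 : (0 < q - 1)%R by rewrite subr_gt0.
have := @conjugate_powR R s (t `^ (q - 1))%R q (q / (q - 1))%R s0 (powR_ge0 _ _) q_gt0.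
rewrite divr_gt0// -powRrM mulrCA divff ?gt_eqF// mulr1 => /(_ isT).
have e : (1 - q^-1 = (q / (q - 1))^-1)%R by field; rewrite !gt_eqF.
by rewrite -e addrC subrK => /(_ erefl) /le_trans; apply; rewrite mulrC lerD2l mulrC.
Qed.

(* Hoelder's inequality against the dual element of the unit vector [k]. *)
Lemma Lp_polar (k : E -> R) : (forall i, 0 <= k i)%R -> Lp_int k = 1 ->
  forall f, \esum_(i in [set: E]) (mu i * `|f i| * k i `^ (q - 1))%:E <= nrm f.
Proof.
move=> k0 k1 f.
(* For unit norm, Young's inequality is summed over the states; the general case follows by
   scaling. *)
have unit f' : nrm f' = 1 ->
    \esum_(i in [set: E]) (mu i * `|f' i| * k i `^ (q - 1))%:E <= 1.
  move=> f1; have If : Lp_int f' = 1 by rewrite -Lp_normX f1 poweR1r.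
  have qV : (0 <= 1 - q^-1)%R by rewrite subr_ge0 invf_le1.
  have qV0 : (0 <= q^-1)%R by rewrite invr_ge0 ltW.
  apply: (@le_trans _ _ (\esum_(i in [set: E])
      ((q^-1 * (mu i * `|f' i| `^ q))%:E + ((1 - q^-1) * (mu i * `|k i| `^ q))%:E))).
    apply: le_esum => i _; rewrite -EFinD lee_fin (ger0_norm (k0 i)).
    have := ler_wpM2l (ltW (hmu i)) (young_powR (normr_ge0 (f' i)) (k0 i)).
    rewrite mulrA => /le_trans; apply.
    by rewrite le_eqVlt; apply/orP; left; apply/eqP; ring.
  rewrite esumD; last 2 first.
  - by move=> i _; rewrite EFinM mule_ge0.
  - by move=> i _; rewrite EFinM mule_ge0.
  rewrite (_ : \esum_(i in _) (q^-1 * _)%:E = (q^-1)%:E * Lp_int f'); last first.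
    by rewrite -esumZl ?invr_gt0.
  rewrite (_ : \esum_(i in _) ((1 - q^-1) * _)%:E = (1 - q^-1)%:E * Lp_int k); last first.
    have [->|q'] := eqVneq (1 - q^-1)%R 0%R.
      by rewrite mul0e esum1// => i _; rewrite mul0r.
    by rewrite -esumZl// lt_neqAle eq_sym q'.
  by rewrite If k1 !mule1 -EFinD addrC subrK.
case Hf : (nrm f) (Lp_norm_ge0 f) => [h| |]// h0; last by rewrite leey.
rewrite lee_fin in h0; have [hz|hn0] := eqVneq h 0%R.
  rewrite esum1 ?hz// => i _.
  have : Lp_int f = 0 by rewrite -Lp_normX Hf hz poweR0r.
  have := @esum_ge_seq _ _ [set: E] (fun i => (mu i * `|f i| `^ q)%:E) [:: i] isT (fun _ _ => I).
  rewrite big_seq1 => /[swap]; rewrite -/(Lp_int f) => ->.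
  rewrite lee_fin pmulr_rle0// => f0.
  have /eqP : (`|f i| `^ q = 0)%R by apply/le_anti; rewrite f0 powR_ge0.
  by rewrite powR_eq0 => /andP[/eqP -> _]; rewrite mulr0 mul0r.
have hpos : (0 < h)%R by rewrite lt_neqAle eq_sym hn0.
have := unit (fun i => h^-1 * f i)%R.
rewrite Lp_norm_scale Hf -EFinM gtr0_norm ?invr_gt0// mulVf// => /(_ erefl).
rewrite -(@lee_pmul2l _ h%:E)// mule1; apply: le_trans.
rewrite -esumZl//; last first.
  by move=> i; rewrite lee_fin mulr_ge0 ?powR_ge0// mulr_ge0// ltW.
apply: le_esum => i _; rewrite -EFinM lee_fin normrM gtr0_norm ?invr_gt0//.
by rewrite le_eqVlt; apply/orP; left; apply/eqP; field.
Qed.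

(** Described by the duality inequality rather than by a conjugate exponent, so that [q = 1] is
    covered uniformly. *)
Definition Lp_dual : set (E -> R) := [set g | (forall i, 0 <= g i)%R /\
  forall f, \esum_(i in [set: E]) (mu i * `|f i| * g i)%:E <= nrm f].

Lemma Lp_normE f : nrm f =
  ereal_sup [set \esum_(i in [set: E]) (mu i * `|f i| * g i)%:E | g in Lp_dual].
Proof.
apply/eqP; rewrite eq_le; apply/andP; split; last first.
  by apply: ge_ereal_sup => _ [g [_ hg] <-].
set S := ereal_sup _.
have dual0 : Lp_dual (cst 0%R).
  by split=> // h; rewrite esum1 ?Lp_norm_ge0// => i _; rewrite mulr0.
have S0 : 0 <= S.
  apply: le_ereal_sup_tmp; eexists; first by exists (cst 0%R).
  by rewrite esum1// => i _; rewrite mulr0.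
suff IS : Lp_int f <= S `^ q.
  have -> : S = (S `^ q) `^ q^-1 by rewrite -poweRrM mulfV// poweRe1.
  by apply: gt0_ler_poweR; rewrite ?in_itv/= ?andbT ?Lp_int_ge0 ?poweR_ge0
    ?invr_ge0 ?(ltW q_gt0)// leey.
apply: esum_le_seq => s us _; rewrite sumEFin.
set F := (\sum_(i <- s) _)%R.
have F0 : (0 <= F)%R by apply: sumr_ge0 => i _; rewrite -lee_fin.
have [->|Fn0] := eqVneq F 0%R; first exact: poweR_ge0.
have Fpos : (0 < F)%R by rewrite lt_neqAle eq_sym Fn0.
pose phi := (F `^ q^-1)%R.
have phi0 : (0 < phi)%R by rewrite powR_gt0.
have phiq : (phi `^ q = F)%R by rewrite /phi -powRrM mulVf// powRr1.
suff phiS : phi%:E <= S.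
  rewrite -phiq -poweR_EFin.
  by apply: gt0_ler_poweR; rewrite ?in_itv/= ?andbT ?S0 ?lee_fin ?(ltW phi0) ?(ltW q_gt0)// leey.
(* [|f|] cut to [s] and normalised, which makes sense even if the norm of [f] is infinite; its dual
   element [k ^ (q - 1)] attains equality in Hoelder's inequality on [s]. *)
pose k (i : E) : R := if i \in s then (`|f i| / phi)%R else 0%R.
have k0 i : (0 <= k i)%R.
  by rewrite /k; case: ifP => // _; rewrite divr_ge0// ltW.
have kq i : i \in s -> (mu i * `|k i| `^ q = mu i * `|f i| `^ q / F)%R.
  move=> si; rewrite ger0_norm// /k si powRM ?invr_ge0 ?(ltW phi0)//.
  by rewrite -powR_inv1 ?(ltW phi0)// powRAC phiq powR_inv1// mulrA.
have sum1 : (\sum_(i <- s) mu i * `|k i| `^ q = 1)%R.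
  rewrite big_seq (eq_bigr _ kq) -big_seq -mulr_suml.
  by rewrite divff.
have Ik : Lp_int k = 1.
  rewrite /Lp_int (@esum_support _ _ [set` s])//; last first.
    by move=> i _ /negP/negbTE si; rewrite /k si normr0 powR0// mulr0.
  rewrite esum_fset; [|exact: finite_seq|by move=> i _].
  by rewrite -fsbig_seq// sumEFin sum1.
apply: le_ereal_sup_tmp; exists (\esum_(i in [set: E]) (mu i * `|f i| * k i `^ (q - 1))%:E).
  exists (fun i => k i `^ (q - 1))%R => //; split; first by move=> i; exact: powR_ge0.
  exact: Lp_polar.
apply: (@le_trans _ _ (\sum_(i <- s) (mu i * `|f i| * k i `^ (q - 1))%:E)); last first.
  exact: esum_ge_seq.
rewrite sumEFin lee_fin; apply: (@le_trans _ _ (phi * \sum_(i <- s) mu i * `|k i| `^ q)%R).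
  by rewrite sum1 mulr1.
rewrite mulr_sumr big_seq [leRHS]big_seq.
rewrite le_eqVlt; apply/orP; left; apply/eqP; apply: eq_bigr => i si.
have fk : (`|f i| = phi * k i)%R by rewrite /k si mulrC divfK// gt_eqF.
by rewrite (ger0_norm (k0 i)) -(mulr_powRB1 (k0 i) q_gt0) fk; ring.
Qed.

(** Minkowski's inequality by duality: each element of [Lp_dual] defines a subadditive
    functional. *)
Lemma Lp_norm_triangle f g : nrm (f \+ g)%R <= nrm f + nrm g.
Proof.
rewrite Lp_normE; apply: ge_ereal_sup => _ [k [k0 hk] <-].
apply: le_trans (leeD (hk f) (hk g)); rewrite -esumD; last 2 first.
- by move=> i _; rewrite lee_fin !mulr_ge0// ltW.
- by move=> i _; rewrite lee_fin !mulr_ge0// ltW.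
apply: le_esum => i _; rewrite -EFinD lee_fin -mulrDl -mulrDr.
by rewrite ler_wpM2r// ler_wpM2l ?ler_normD// ltW.
Qed.

(** Geometric weights along the injection [pickle] of the countable state space into the
    naturals. *)
Lemma esum_geometric_state :
  exists2 w : E -> R, (forall i, 0 < w i)%R & \esum_(i in [set: E]) (w i)%:E <= 1.
Proof.
exists (fun i => 1 / (2 ^ (pickle i).+1)%:R)%R.
  by move=> i; rewrite divr_gt0// ltr0n expn_gt0.
pose u (n : nat) : \bar R := (1 / (2 ^ n.+1)%:R)%:E.
have u0 n : 0 <= u n by rewrite lee_fin divr_ge0.
have := @esum_image R E nat setT pickle u (in2W (pcan_inj pickleK)).
rewrite /u => <-; apply: (@le_trans _ _ (\esum_(n in [set: nat]) u n)).
  exact: esum_subset.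
by rewrite -nneseries_esumT// epsilon_trick0.
Qed.

Lemma finite_inf_gt0 (g : E -> R) : (forall i, 0 < g i)%R -> locally_positive g.
Proof.
move=> g0 _ /finite_seqP[s ->].
have [e e0 he] : exists2 e : R, (0 < e)%R & forall i, i \in (s : seq E) -> (e <= g i)%R.
  elim: (s : seq E) => [|x r [e e0 he]]; first by exists 1%R.
  exists (Num.min e (g x)); first by rewrite lt_min e0 g0.
  move=> i; rewrite inE => /orP[/eqP ->|/he h]; first by rewrite ge_min lexx orbT.
  by rewrite ge_min h.
apply: (@lt_le_trans _ _ e%:E) => //.
by apply: le_ereal_inf_tmp => _ [i /= /he h <-]; rewrite lee_fin.
Qed.

Lemma Lp_dual_locally_positive (theta : E) :
  exists g, Lp_dual g /\ locally_positive g.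
Proof.
have [w w0 w1] := esum_geometric_state.
set W := \esum_(i in _) _ in w1.
have Wpos : 0 < W.
  have := @esum_ge_seq _ _ [set: E] (fun i => (w i)%:E) [:: theta] isT (fun _ _ => I).
  by rewrite big_seq1; apply: lt_le_trans; rewrite lte_fin.
have [r WE] : exists r : R, W = r%:E.
  by case: W Wpos w1 => [r| |]// _ _; exists r.
have r0 : (0 < r)%R by rewrite -lte_fin -WE.
(* Chosen so that [mu i * k i ^ q = w i / r], whose total is 1; the dual element of this positive
   unit vector is positive everywhere. *)
pose k (i : E) : R := ((w i / r / mu i) `^ q^-1)%R.
have wr i : (0 < w i / r / mu i)%R by rewrite !divr_gt0.
have k0 i : (0 < k i)%R by rewrite powR_gt0.
exists (fun i => k i `^ (q - 1))%R; split; last first.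
  by apply: finite_inf_gt0 => i; rewrite powR_gt0.
split; first by move=> i; exact: powR_ge0.
apply: Lp_polar; first by move=> i; exact: ltW.
transitivity (\esum_(i in [set: E]) ((r^-1)%:E * (w i)%:E)).
  apply: eq_esum => i _; rewrite gtr0_norm// /k -powRrM mulVf// powRr1 ?ltW//.
  by rewrite -EFinM; congr EFin; field; rewrite !gt_eqF.
rewrite esumZl ?invr_gt0//; last by move=> i; rewrite lee_fin ltW.
by rewrite -/W WE -EFinM mulVf// gt_eqF.
Qed.

Lemma Lp_int_indic (K : set E) : Lp_int (\1_K) = \esum_(i in K) (mu i)%:E.
Proof.
rewrite [RHS]esum_mkcond; apply: eq_esum => i _; rewrite indicE.
by case: (i \in K); rewrite ?normr1 ?powR1 ?mulr1// normr0 powR0// mulr0.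
Qed.

Lemma Lp_norm_indic (K : set E) :
  nrm \1_K = (\esum_(i in K) (mu i)%:E) `^ q^-1.
Proof. by rewrite -Lp_int_indic. Qed.

Lemma esum_finite_lty (K : set E) (h : E -> R) : finite_set K ->
  (forall i, 0 <= h i)%R -> \esum_(i in K) (h i)%:E < +oo.
Proof.
move=> fK h0; rewrite esum_fset; [|by []|by move=> i _; rewrite lee_fin].
by rewrite fsumEFin// ltry.
Qed.

Lemma Lp_admissible (theta : E) :
  admissible mu (Lp_space mu q) nrm Lp_dual.
Proof.
have nrm0 : nrm (cst 0%R) = 0.
  by rewrite /Lp_norm esum1 ?poweR0r// => i _; rewrite normr0 powR0// mulr0.
split.
- split.
  + by rewrite /Lp_space/= nrm0.
  + move=> c f g /= hf hg; apply: le_lt_trans (Lp_norm_triangle (fun i => c * f i)%R g) _.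
    by rewrite Lp_norm_scale lte_add_pinfty// lte_mul_pinfty// ?lee_fin.
  + by move=> f hf; rewrite ge0_fin_numE ?Lp_norm_ge0.
  + by move=> c f _; exact: Lp_norm_scale.
  + by move=> f g _ _; exact: Lp_norm_triangle.
  + move=> f _ f0 i.
    have : Lp_int f = 0 by rewrite -Lp_normX f0 poweR0r.
    have := @esum_ge_seq _ _ [set: E] (fun i => (mu i * `|f i| `^ q)%:E) [:: i] isT (fun _ _ => I).
    rewrite big_seq1 => /[swap]; rewrite -/(Lp_int f) => ->.
    rewrite lee_fin pmulr_rle0// => fi0.
    have /eqP : (`|f i| `^ q = 0)%R by apply/le_anti; rewrite fi0 powR_ge0.
    by rewrite powR_eq0 normr_eq0 => /andP[/eqP].
- rewrite /H1; case: ifPn => [_ K fK|muE].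
    by rewrite /Lp_space/= Lp_norm_indic poweR_lty// esum_finite_lty// => i; exact: ltW.
  rewrite /Lp_space/= /Lp_norm poweR_lty// ltey.
  by under eq_esum do rewrite normr1 powR1 mulr1.
- move=> f h hh fh; apply: le_lt_trans hh; rewrite /Lp_norm.
  apply: gt0_ler_poweR; rewrite ?in_itv/= ?andbT ?Lp_int_ge0 ?invr_ge0 ?(ltW q_gt0) ?leey//.
  apply: le_esum => i _; rewrite lee_fin ler_wpM2l ?(ltW (hmu i))//.
  have h0 : (0 <= h i)%R by apply: le_trans (fh i).
  by apply: ge0_ler_powR; rewrite ?nnegrE ?(ltW q_gt0)// (ger0_norm h0).
- split; first by move=> g [].
  exact: Lp_normE.
- exact: Lp_dual_locally_positive theta.
Qed.

(** The mass of [K] is finite and positive, so that inverting the power amounts to negating its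
    exponent. *)
Lemma inve_Lp_norm_indic (K : set E) : finite_set K -> K !=set0 ->
  (nrm \1_K)^-1 = (\esum_(i in K) (mu i)%:E) `^ (- q^-1).
Proof.
move=> fK [x Kx]; rewrite Lp_norm_indic.
have lt1 := esum_finite_lty fK (fun i => ltW (hmu i)).
have gt0 : 0 < \esum_(i in K) (mu i)%:E.
  have := @esum_ge_seq _ _ K (fun i => (mu i)%:E) [:: x] isT.
  rewrite big_seq1 => h; apply: lt_le_trans (h _); first by rewrite lte_fin.
  by move=> y; rewrite inE => /eqP ->.
case: (\esum_(i in K) _) lt1 gt0 => [m| |]// _; rewrite lte_fin => m0.
by rewrite poweRN// poweR_EFin inver gt_eqF ?powR_gt0.
Qed.

End LpNorm.

Theorem theorem8p2 (R : realType) (M N : \bar int)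
    (a b mu : state M N -> R) (theta : state M N)
    (ha : forall i, (0 < a i)%R) (hb : forall i, (0 < b i)%R)
    (hmu : forall i, (0 < mu i)%R) (hrev : reversible a b mu) :
  (forall (B : set (state M N -> R)) (nrm : (state M N -> R) -> \bar R)
     (G : set (state M N -> R)),
     admissible mu B nrm G ->
     isoperimetric_constant a b mu nrm <= optimal_constant a b mu theta nrm /\
     optimal_constant a b mu theta nrm
       <= 4%:E * isoperimetric_constant a b mu nrm) /\
  (forall p : R, (2 <= p)%R ->
     (exists G : set (state M N -> R),
        admissible mu (Lp_space mu (p / 2)) (Lp_norm mu (p / 2)) G) /\
     (isoperimetric_constant a b mu (Lp_norm mu (p / 2)))^-1 =
       ereal_inf
         [set ((left_resistance a mu mn.1)^-1
                + (right_resistance b mu mn.2)^-1)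
              * (\esum_(j in itv_state mn.1 mn.2) (mu j)%:E) `^ (- (2 / p))
         | mn in [set mn : state M N * state M N
                  | (val mn.1 <= val mn.2)%R]]).
Proof.
split => [B nrm G adm|p p2].
  by split; [exact: (optimal_ge _ ha hb hmu hrev adm)|exact: (optimal_le _ ha hb hmu hrev adm)].
have q1 : (1 <= p / 2)%R by rewrite ler_pdivlMr// mul1r.
split; first by exists (Lp_dual mu (p / 2)); exact: Lp_admissible.
rewrite /isoperimetric_constant inveK; congr ereal_inf.
apply: eq_imagel => -[m n] /= mn.
rewrite (inve_Lp_norm_indic hmu q1); first by rewrite invf_div.
  exact: finite_itv_state.
by exists m; rewrite /itv_state/= lexx.
Qed.
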